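(* Let $n \ge 2$ and $0 \le \lambda \le n-2$ be integers. Then there exist a neighbourhood $U$ of the unit sphere $S^{n-1}$ inside the closed unit ball $B^n_{\mathbf 0}(1)$ and a Morse function without critical points $f\colon U \to \mathbb{R}$ that admits both index $\lambda$ and index $\lambda+2$.
   Context: $B^n_{\mathbf 0}(1) = \{x \in \mathbb{R}^n : |x| \le 1\}$, $S^{n-1} = \{x \in \mathbb{R}^n : |x| = 1\}$, and $\mathbf 0$ is the origin of $\mathbb{R}^n$. Smooth means $C^\infty$. For a smooth function $f$ on a smooth manifold $M$ (possibly with boundary $\partial M$), $\operatorname{Crit} f$ is the set of points where $df$ vanishes on the whole tangent space of $M$; a critical point is non-degenerate (Morse) if the Hessian form of $f$ at it is non-degenerate, and its Morse index $\mu_f(p)$ is the maximal dimension of a subspace of $T_pM$ on which the Hessian form is negative definite. A smooth function $f\colon M \to \mathbb{R}$ on a smooth manifold $M$ with boundary $\partial M$ is called a Morse function if (1) no critical point of $f$ lies in $\partial M$; (2) all critical points of $f$ are non-degenerate; (3) all critical points of the restriction $f|_{\partial M}$ are non-degenerate. A neighbourhood $U$ of $S^{n-1}$ inside $B^n_{\mathbf 0}(1)$ is regarded as a manifold with boundary $S^{n-1}$. Let $U \subset B^n_{\mathbf 0}(1)$ be a neighbourhood of $S^{n-1}$ and $f\colon U \to \mathbb{R}$ a Morse function without critical points. One says that $f$ admits index $\lambda$ if there exists a Morse function $F\colon B^n_{\mathbf 0}(1) \to \mathbb{R}$ such that $F|_U = f$, $\operatorname{Crit} F = \{\mathbf 0\}$,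 and $\mu_F(\mathbf 0) = \lambda$. *)

(* Defs.v *)
From mathcomp Require Export all_boot all_order all_algebra.
From mathcomp Require Export all_classical all_reals all_analysis.
Export numFieldNormedType.Exports.
Import Order.TTheory GRing.Theory Num.Theory.

Set Implicit Arguments.
Unset Strict Implicit.
Unset Printing Implicit Defensive.

Local Open Scope classical_set_scope.
Local Open Scope ring_scope.

Section Definitions.
Variables (R : realType) (n : nat).
Local Notation E := 'rV[R]_n.

(* The norm that the library puts on [E] is the sup norm (with the usual
   topology); the ball and the sphere need the Euclidean one. *)
Definition dot (x y : E) : R := \sum_(i < n) x 0 i * y 0 i.
Definition enorm (x : E) : R := Num.sqrt (dot x x).

Definition unit_ball : set E := [set x | enorm x <= 1].
Definition unit_sphere : set E := [set x | enorm x = 1].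

(* Neighbourhoods are taken relatively open in the closed ball, so that they
   are manifolds with boundary equal to the sphere. *)
Definition sphere_nbhd (U : set E) : Prop :=
  (exists2 O : set E, open O & U = unit_ball `&` O) /\ unit_sphere `<=` U.

Fixpoint partials (s : seq 'I_n) (g : E -> R) : E -> R :=
  if s is i :: s' then 'D_(delta_mx 0 i) (partials s' g) else g.

Definition smooth_on_open (W : set E) (g : E -> R) : Prop :=
  forall (s : seq 'I_n) (x : E), W x ->
    {for x, continuous (partials s g)} /\
    (forall i : 'I_n, derivable (partials s g) x (delta_mx 0 i)).

(* In what follows, [M] is [unit_ball] or a set satisfying [sphere_nbhd], and
   a function on [M] is represented by a total function whose values outside
   [M] are irrelevant.  Up to the boundary, smoothness means existence of
   local smooth extensions to open subsets of [E].  As [M] is contained in the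
   closure of its interior, the derivatives of [g] at [x] do not depend on the
   choice of the local extension [g]; they are the derivatives of [f]. *)
Definition local_extension (M : set E) (f : E -> R) (x : E) (g : E -> R) :=
  exists W : set E, [/\ open W, W x, smooth_on_open W g &
    forall y, W y -> M y -> g y = f y].

Definition smooth_on (M : set E) (f : E -> R) : Prop :=
  forall x, M x -> exists g, local_extension M f x g.

(* The tangent space at every point of [M], boundary points included, is the
   whole of [E]. *)
Definition crit (M : set E) (f : E -> R) : set E :=
  [set x | M x /\ exists2 g, local_extension M f x g &
                             forall v : E, 'D_v g x = 0].

Definition hessian (g : E -> R) (x v w : E) : R := 'D_v ('D_w g) x.

Definition nondegenerate_on (T : set E) (H : E -> E -> R) : Prop :=
  forall v, T v -> (forall w, T w -> H v w = 0) -> v = 0.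

Definition negative_definite_on (V : {vspace E}) (H : E -> E -> R) : Prop :=
  forall v, v \in V -> v != 0 -> H v v < 0.

Definition form_index (H : E -> E -> R) (k : nat) : Prop :=
  (exists2 V : {vspace E}, negative_definite_on V H & \dim V = k) /\
  (forall V : {vspace E}, negative_definite_on V H -> (\dim V <= k)%N).

Definition nondegenerate_at (M : set E) (f : E -> R) (p : E) : Prop :=
  exists2 g, local_extension M f p g & nondegenerate_on setT (hessian g p).

Definition morse_index (M : set E) (f : E -> R) (p : E) (k : nat) : Prop :=
  exists2 g, local_extension M f p g & form_index (hessian g p) k.

Definition sphere_tangent (p : E) : set E := [set v | dot p v = 0].

(* For [p] on the sphere, the restriction of [sphere_param p] to
   [sphere_tangent p] is a local parametrization of the sphere sending 0 to
   [p], whose differential at 0 is the inclusion of the tangent space.  The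
   differential and the Hessian form of the restriction of [f] to the sphere
   are computed in it; only directions in [sphere_tangent p], hence only
   values of [f] on the sphere, are involved. *)
Definition sphere_param (p u : E) : E := (enorm (p + u))^-1 *: (p + u).

Definition crit_bd (f : E -> R) : set E :=
  [set p | unit_sphere p /\
    forall v, sphere_tangent p v -> 'D_v (f \o sphere_param p) 0 = 0].

Definition nondegenerate_bd_at (f : E -> R) (p : E) : Prop :=
  nondegenerate_on (sphere_tangent p) (hessian (f \o sphere_param p) 0).

Definition morse (M : set E) (f : E -> R) : Prop :=
  [/\ smooth_on M f,
      crit M f `&` unit_sphere = set0,
      forall p, crit M f p -> nondegenerate_at M f p &
      forall p, crit_bd f p -> nondegenerate_bd_at f p].

Definition admits_index (U : set E) (f : E -> R) (lam : nat) : Prop :=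
  exists F : E -> R,
    [/\ morse unit_ball F,
        forall x, U x -> F x = f x,
        crit unit_ball F = [set 0] &
        morse_index unit_ball F 0 lam].

End Definitions.

(* Main.v *)
From HB Require Import structures.
Require Import Defs.
From mathcomp Require Import ring lra.
Import Order.TTheory GRing.Theory Num.Theory.

Set Implicit Arguments.
Unset Strict Implicit.
Unset Printing Implicit Defensive.

Local Open Scope classical_set_scope.
Local Open Scope ring_scope.

(** Write [x], [y] for the first two coordinates and [z] for the others.  Near
    the sphere the common function is [base], that is
      [x^3 / (3 a^2) + x valley(y) + sum_i e_i z_i^2],
    where [a] is small and [valley] is a cubic which on [[-1, 1]] first
    decreases, staying negative, until [y = 1/10] and then increases through a
    single zero.  In the plane [z = 0] the unit disc contains three critical
    points of it: a saddle on the axis [x = 0], at the zero of [valley], and at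
    height [y = 1/10] a minimum with [x > 0] and its mirror image, a maximum with
    [x < 0].  Adding [a hill(y)], where [hill] is flat for [y <= -1/10] and then
    increases steeply, cancels the saddle against the maximum, so that only a
    minimum is left.  The planar part of [base] is odd in [x]; hence, by the
    reflection in [x], subtracting [a hill(y)] cancels the saddle against the
    minimum and leaves only a maximum.  Cut off inside the ball, the two
    modifications of the same function have indices differing by 2; the squares
    [e_i z_i^2], [lam] of them negative, add [lam] to both.  This is [model sg],
    for the two signs [sg].

    Critical points of [model] are controlled by two scales.  After the
    substitution [x = sg a xi] the planar equations become
      [xi^2 + valley y = 0] and [xi valley' y + hill' y = 0],
    which no longer involve [a] or [sg] and have the single solution [xi = 1],
    [y = 0] ([scaled_crit]); the terms created by the cutoff are negligible
    against [x^2 / a^2] when [a] is small ([planar_crit]).  Large [|e_i|] force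
    [z = 0] ([crit_model]).  The remaining point [(sg a, 0, 0)] is brought to
    the origin by the shear [x + sg a cut(|p|^2)], which is supported inside the
    ball and does not affect the vanishing of the gradient.  Around the origin
    [model] is the explicit function [germ], whose Hessian form splits into a
    form of sign [sg] in the plane and the diagonal form of the [2 e_i].

    On the sphere, let [mu] be the Lagrange multiplier at a critical point of
    the restriction of [base].  If some [z_i] is nonzero there, then
    [mu = 2 e_i], which differs from all the other [2 e_j] and dominates the
    planar second derivatives: the critical point is non-degenerate.  Otherwise
    it lies on the unit circle of the plane, where [|mu|] is smaller than all
    [2 |e_i|], and the second derivative along the circle is dominated by
    [x (3 y^2 - 1) / a^2] ([circle_nondeg]).  The lemma
    [nondegenerate_bd_base] puts this together. *)

(** * Flat functions and a cutoff *)

Section FlatFunctions.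
Variable R : realType.
Implicit Types (t x : R) (N : nat).

(** The functions [t^-N exp (-1/t)] are taken together because their linear span
    is stable under differentiation, which makes smoothness an induction. *)
Definition flat N t : R := if 0 < t then t ^- N * expR (- t^-1) else 0.

Lemma flat_le0 N t : t <= 0 -> flat N t = 0.
Proof. by rewrite /flat ltNge => ->. Qed.

Lemma flat_gt0 N t : 0 < t -> 0 < flat N t.
Proof. by move=> t0; rewrite /flat t0 mulr_gt0 ?expR_gt0// invr_gt0 exprn_gt0. Qed.

Lemma flat_ge0 N t : 0 <= flat N t.
Proof.
by case: (lerP t 0) => t0; [rewrite flat_le0 | exact/ltW/flat_gt0].
Qed.

Lemma flatS N t : flat N t = t * flat N.+1 t.
Proof.
have [t0|t0] := leP t 0; first by rewrite !flat_le0// mulr0.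
by rewrite /flat t0 mulrA -!exprVn exprS mulrA divff ?gt_eqF// mul1r.
Qed.

(** With [u = 1/t] this is the bound of [u^(N+k)] by [(N+k)! exp u]. *)
Lemma flat_upper N k t : 0 <= t -> flat N t <= (N + k)`!%:R * t ^+ k.
Proof.
rewrite le_eqVlt => /orP[/eqP<-|t0].
  by rewrite flat_le0// mulr_ge0// exprn_ge0.
have u0 : 0 <= t^-1 by rewrite invr_ge0 ltW.
have H : t^-1 ^+ (N + k) <= expR t^-1 * (N + k)`!%:R.
  case: (N + k)%N => [|j]; first by rewrite expr0 fact0 mulr1 -expR0 ler_expR.
  have := expR_ge1Dxn j u0.
  have fpos : 0 < j.+1`!%:R :> R by rewrite ltr0n fact_gt0.
  by move=> /(le_trans (ler_wpDl ler01 (lexx _))); rewrite ler_pdivrMr.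
rewrite /flat t0 expRN -exprVn ler_pdivrMr ?expR_gt0//.
have -> : t^-1 ^+ N = t ^+ k * t^-1 ^+ (N + k).
  by rewrite exprD mulrCA -exprMn divff ?gt_eqF// expr1n mulr1.
rewrite -mulrA mulrCA ler_wpM2l ?exprn_ge0 ?(ltW t0)//.
by rewrite mulrC.
Qed.

Lemma flat_le_fact N t : flat N t <= N`!%:R.
Proof.
have [t0|/ltW t0] := leP 0 t; last by rewrite flat_le0.
by have := flat_upper N 0 t0; rewrite addn0 expr0 mulr1.
Qed.

Lemma is_derive_sqr_bound (f : R -> R) (K : R) :
  (forall h, `|f h| <= K * h ^+ 2) -> is_derive (0 : R) (1 : R) f 0.
Proof.
move=> fK.
have f0 : f 0 = 0.
  by apply/eqP; rewrite -normr_le0; have := fK 0; rewrite expr0n mulr0.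
have lim0 : (fun h => h^-1 *: ((f \o shift 0) (h *: (1 : R)) - f 0)) @ 0^' --> (0 : R).
  have K0 : 0 <= K by have := fK 1; rewrite expr1n mulr1; apply: le_trans.
  apply/cvgrPdist_le => e e0; near=> h.
  have hn0 : h != 0 by near: h; exact: nbhs_dnbhs_neq.
  rewrite sub0r normrN /= f0 subr0 addr0 /GRing.scale/= mulr1 normrM normfV.
  rewrite ler_pdivrMl ?normr_gt0//; apply: (le_trans (fK h)).
  rewrite -(real_normK (num_real h)) expr2 mulrCA ler_wpM2l//.
  have : `|h| <= e / (K + 1).
    near: h; apply: (@dnbhs0_le _ R); rewrite divr_gt0// ltr_wpDl//.
  rewrite ler_pdivlMr ?ltr_wpDl//; apply: le_trans.
  by rewrite mulrC ler_wpM2l// lerDl.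
by apply: DeriveDef; [apply/cvg_ex; exists 0 | apply/cvg_lim].
Unshelve. all: by end_near. Qed.

(** Away from [0] this is the product rule; at [0], [flat N] is bounded by a
    multiple of [t^2]. *)
Lemma is_derive_flat N t :
  is_derive t (1 : R) (flat N) (flat N.+2 t - N%:R * flat N.+1 t).
Proof.
have [t0|t0|->] := ltgtP t 0.
- rewrite !flat_le0 ?ltW// mulr0 subr0.
  have cst0 : \near t, cst (0 : R) t = flat N t.
    near=> s; rewrite flat_le0// ltW//; near: s; exact: lt_nbhsl.
  exact: near_eq_is_derive cst0 (is_derive_cst _ _ _).
- have eqf : \near t, (t^-1) ^+ N * expR (- t^-1) = flat N t.
    near=> s; rewrite /flat ifT ?exprVn//; near: s; exact: lt_nbhsr.
  apply: (near_eq_is_derive eqf).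
  have tn0 : t != 0 by rewrite gt_eqF.
  have dV : is_derive t (1 : R) (@GRing.inv R) (- t ^- 2).
    have := @is_deriveV R id t 1 1 tn0 (is_derive_id _ _).
    by rewrite /GRing.scale/= mulr1.
  have dX := @is_deriveX _ _ (@GRing.inv R) N t 1 _ dV.
  rewrite exprfctE in dX.
  have dE : is_derive t (1 : R) (fun s => expR (- s^-1)) (expR (- t^-1) * t ^- 2).
    have dN := is_deriveN dV; rewrite opprK in dN.
    exact: (@is_derive1_comp _ (@expR R) (fun s => - s^-1) t _ _ (is_derive_expR _) dN).
  apply: (is_derive_eq (@is_deriveM _ _ _ _ t 1 _ _ dX dE)).
  rewrite /flat t0 /GRing.scale/= -!exprVn.
  case: N {dX eqf} => [|N]; rewrite ?mul0r ?mul0rn ?mulr0 ?subr0 ?addr0/=.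
    by rewrite expr0; ring.
  rewrite !exprS; ring.
- rewrite !flat_le0// mulr0 subr0.
  apply: (@is_derive_sqr_bound _ (N + 2)`!%:R) => h.
  rewrite ger0_norm ?flat_ge0//.
  have [h0|h0] := leP 0 h; first exact: flat_upper.
  by rewrite flat_le0 ?(ltW h0)// mulr_ge0 ?ler0n ?sqr_ge0.
Unshelve. all: by end_near. Qed.

(** [flat 0] is convex up to [1/2], since
    [flat 4 - 2 flat 3 = (1 - 2 t) flat 4]. *)
Lemma flat2_homo s t : s <= t -> t <= 1/2 -> flat 2 s <= flat 2 t.
Proof.
rewrite le_eqVlt => /orP[/eqP->//|st] t12.
have [||c] := @MVT R (flat 2) (fun c => flat 4 c - 2%:R * flat 3 c) s t st.
- by move=> x _; exact: is_derive_flat.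
- apply: derivable_within_continuous => x _.
  by have [] := is_derive_flat 2 x.
rewrite in_itv/= => /andP[sc ct] /eqP; rewrite subr_eq => /eqP ->.
rewrite lerDr mulr_ge0 ?subr_ge0 ?(ltW st)//.
rewrite (flatS 3) mulrA -[leRHS]mul1r ler_wpM2r ?flat_ge0//; lra.
Qed.

(** A plateau function obtained by composition, without any division:
    [1 - 2 flat 0 s] is [1] for [s <= 0] and nonpositive for [s >= 2], so that a
    second application of [flat 0] gives the constant [exp (-1)] and then [0]. *)
Definition cut t : R := expR 1 * flat 0 (1 - 2 * flat 0 (8 * t - 4)).

Definition dcut t : R :=
  - 16 * expR 1 * flat 2 (1 - 2 * flat 0 (8 * t - 4)) * flat 2 (8 * t - 4).

Lemma cut1 t : t <= 1/2 -> cut t = 1.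
Proof.
move=> t12; rewrite /cut [flat 0 (8 * t - 4)]flat_le0; last by lra.
by rewrite mulr0 subr0 /flat ltr01 expr0 !invr1 mul1r -expRD subrr expR0.
Qed.

Lemma cut0 t : 3/4 <= t -> cut t = 0.
Proof.
move=> t34; rewrite /cut [X in _ * X]flat_le0 ?mulr0//.
set s := 8 * t - 4; have s2 : 2 <= s by rewrite /s; lra.
have s0 : 0 < s by lra.
rewrite /flat s0 expr0 invr1 mul1r.
(* exp (-1/s) is at least 1 - 1/s, hence at least 1/2 *)
have := expR_ge1Dx (- s^-1).
have : s^-1 <= 2^-1 by rewrite lef_pV2 ?posrE.
lra.
Qed.

Lemma cut_itv t : 0 <= cut t <= 1.
Proof.
rewrite /cut mulr_ge0 ?expR_ge0 ?flat_ge0//=.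
set s := 1 - _; have s1 : s <= 1 by rewrite /s gerBl mulr_ge0 ?flat_ge0.
rewrite /flat; case: ifPn => [s0|_]; last by rewrite mulr0.
by rewrite expr0 invr1 mul1r -expRD expR_le1 subr_le0 -{1}invr1 lef_pV2 ?posrE.
Qed.

Lemma is_derive_cut t : is_derive t (1 : R) cut (dcut t).
Proof.
have d1 : is_derive t (1 : R) (fun s => 8 * s - 4) 8.
  have := is_deriveB (is_deriveZ 8 (is_derive_id t (1 : R))) (is_derive_cst (4 : R) t (1 : R)).
  by rewrite subr0 /GRing.scale/= mulr1.
have d2 := @is_derive1_comp R (flat 0) _ t _ _ (is_derive_flat 0 (8 * t - 4)) d1.
have d3 := is_deriveB (is_derive_cst (1 : R) t (1 : R)) (is_deriveZ 2 d2).
have d4 := is_deriveZ (expR 1)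
  (@is_derive1_comp R (flat 0) (fun s => 1 - 2 * flat 0 (8 * s - 4)) t _ _
    (is_derive_flat 0 (1 - 2 * flat 0 (8 * t - 4))) d3).
apply: (is_derive_eq d4); rewrite /dcut /GRing.scale/=; ring.
Qed.

Lemma dcut_bound t : `|dcut t| <= 64 * expR 1.
Proof.
have f2 s : flat 2 s <= 2 by exact: flat_le_fact.
rewrite /dcut !normrM normrN !ger0_norm ?flat_ge0 ?expR_ge0//.
rewrite (_ : 64 * _ = 16 * expR 1 * 2 * 2); last by ring.
by rewrite !ler_pM ?mulr_ge0 ?flat_ge0 ?expR_ge0.
Qed.

Lemma dcut_eq0 t : t <= 1 / 2 -> dcut t = 0.
Proof. by move=> t12; rewrite /dcut [flat 2 (8 * t - 4)]flat_le0 ?mulr0//; lra. Qed.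

End FlatFunctions.

(** * Gradients and smooth functions *)

Section SmoothFunctions.
Variables (R : realType) (n : nat).
Local Notation E := 'rV[R]_n.
Implicit Types (f g : E -> R) (p x v w : E) (i j : 'I_n).

Lemma dotC x v : dot x v = dot v x.
Proof. by apply: eq_bigr => i _; rewrite mulrC. Qed.

Lemma dotDl x v w : dot (x + v) w = dot x w + dot v w.
Proof. by rewrite -big_split; apply: eq_bigr => i _; rewrite mxE mulrDl. Qed.

Lemma dotZl (k : R) x v : dot (k *: x) v = k * dot x v.
Proof. by rewrite mulr_sumr; apply: eq_bigr => i _; rewrite mxE mulrA. Qed.

Lemma dotDr x v w : dot x (v + w) = dot x v + dot x w.
Proof. by rewrite dotC dotDl !(dotC x). Qed.

Lemma dotZr (k : R) x v : dot x (k *: v) = k * dot x v.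
Proof. by rewrite dotC dotZl dotC. Qed.

Lemma dot0l x : dot 0 x = 0.
Proof. by rewrite -(scale0r (0 : E)) dotZl mul0r. Qed.

Lemma dotNl x v : dot (- x) v = - dot x v.
Proof. by rewrite -scaleN1r dotZl mulN1r. Qed.

Lemma dot_suml m (x : 'I_m -> E) v : dot (\sum_j x j) v = \sum_j dot (x j) v.
Proof.
rewrite /dot exchange_big/=; apply: eq_bigr => i _.
by rewrite summxE mulr_suml.
Qed.

Lemma dot_delta i v : dot (delta_mx 0 i) v = v 0 i.
Proof.
rewrite /dot (bigD1 i)//= big1 ?addr0 => [|j ji]; rewrite !mxE !eqxx ?mul1r//.
by rewrite (negbTE ji) mul0r.
Qed.

Lemma dot_ge0 x : 0 <= dot x x.
Proof. by apply: sumr_ge0 => i _; rewrite -expr2 sqr_ge0. Qed.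

Lemma coord_sqr_le i p : p 0 i ^+ 2 <= dot p p.
Proof.
rewrite /dot (bigD1 i)//= -expr2 lerDl sumr_ge0// => j _.
by rewrite -expr2 sqr_ge0.
Qed.

Lemma dot_eq0 x : dot x x = 0 -> x = 0.
Proof.
move=> /eqP; rewrite psumr_eq0 => [/allP xx|i _]; last by rewrite -expr2 sqr_ge0.
apply/rowP => i; have /eqP := xx i (mem_index_enum i).
by move=> /eqP; rewrite mxE mulf_eq0 orbb => /eqP.
Qed.

(** Lagrange multipliers on the unit sphere: the tangent space at [p] is the
    orthogonal of [p]. *)
Lemma orthogonal_normal p x : dot p p = 1 ->
  (forall v, dot p v = 0 -> dot x v = 0) -> x = dot p x *: p.
Proof.
move=> p1 xv; apply/eqP; rewrite -subr_eq0; apply/eqP/dot_eq0.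
set v := x - _; have pv : dot p v = 0 by rewrite dotDr -scaleNr dotZr p1; ring.
by rewrite {1}/v -scaleNr dotDl dotZl xv// pv mulr0 addr0.
Qed.

Lemma enorm_le1 x : enorm x <= 1 <-> dot x x <= 1.
Proof. by rewrite /enorm -{1}(@sqrtr1 R) ler_sqrt ?ler01. Qed.

Lemma enorm_eq1 x : enorm x = 1 <-> dot x x = 1.
Proof.
rewrite /enorm; split => [x1|->]; last by rewrite sqrtr1.
by rewrite -(sqr_sqrtr (dot_ge0 x)) x1 expr1n.
Qed.

Definition grad_at f x (d : E) :=
  differentiable f x /\ forall v, 'D_v f x = dot d v.

Lemma differentiable_grad_at f x : differentiable f x ->
  grad_at f x (\row_i 'D_(delta_mx 0 i) f x).
Proof.
move=> fx; split => // v; rewrite deriveE// {1}(row_sum_delta v) linear_sum.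
by apply: eq_bigr => i _; rewrite linearZ mxE deriveE// mulrC.
Qed.

Lemma grad_at_crit f x d : grad_at f x d -> (forall v, 'D_v f x = 0) -> d = 0.
Proof.
move=> [_ fd] D0; apply/rowP => i.
by rewrite -dot_delta dotC -fd D0 mxE.
Qed.

Lemma grad_at_eq f x (d d' : E) : grad_at f x d -> d = d' -> grad_at f x d'.
Proof. by move=> fd <-. Qed.

Lemma grad_at_cst (c : R) x : grad_at (fun=> c) x 0.
Proof. by split=> [|v]; [exact: differentiable_cst | rewrite dot0l derive_cst]. Qed.

Lemma grad_at_coord i x : grad_at (fun y => y 0 i) x (delta_mx 0 i).
Proof.
have dx := @differentiable_coord R 1 n x 0 i; split=> // v.
rewrite dot_delta.
suff: is_derive x v (fun y : E => y 0 i) (v 0 i) by case.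
apply: DeriveDef; first exact: diff_derivable.
apply/cvg_lim => //.
apply: cvg_near_cst; near=> h.
have h0 : h != 0 by near: h; exact: nbhs_dnbhs_neq.
by rewrite /= !mxE addrK /GRing.scale/= mulrA mulVf ?mul1r.
Unshelve. all: by end_near. Qed.

Lemma grad_atD f g x d e : grad_at f x d -> grad_at g x e ->
  grad_at (fun y => f y + g y) x (d + e).
Proof.
move=> [df fd] [dg gd]; split=> [|v]; first exact: differentiableD.
by rewrite dotDl -fd -gd -deriveD//; exact: diff_derivable.
Qed.

Lemma grad_atM f g x d e : grad_at f x d -> grad_at g x e ->
  grad_at (fun y => f y * g y) x (f x *: e + g x *: d).
Proof.
move=> [df fd] [dg gd]; split=> [|v]; first exact: differentiableM.
by rewrite dotDl !dotZl -fd -gd -deriveM//; exact: diff_derivable.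
Qed.

Lemma grad_at_comp (phi : R -> R) f x (phi' : R) d :
  is_derive (f x) 1 phi phi' -> grad_at f x d ->
  grad_at (fun y => phi (f y)) x (phi' *: d).
Proof.
move=> [dphi phiE] [df fd].
have dphi' : differentiable phi (f x) by exact/derivable1_diffP.
split=> [|v]; first exact: (differentiable_comp df).
rewrite deriveE; last exact: (differentiable_comp df).
rewrite -[fun y => _]/(phi \o f) diff_comp//= -(deriveE v df) fd.
by rewrite diff1E// derive1E phiE dotZl mulrC.
Qed.

Lemma grad_at_sum m (f : 'I_m -> E -> R) x (d : 'I_m -> E) :
  (forall j : 'I_m, grad_at (f j) x (d j)) ->
  grad_at (fun y => \sum_(j < m) f j y) x (\sum_(j < m) d j).
Proof.
elim: m f d => [|m IH] f d fd.
  by under eq_fun do rewrite big_ord0; rewrite big_ord0; exact: grad_at_cst.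
under eq_fun do rewrite big_ord_recr/=; rewrite big_ord_recr/=.
by apply: grad_atD => //; exact: IH.
Qed.

(** The Hessian form is read off the gradients [H j] of the entries of a
    gradient that is known on the whole space. *)
Lemma hessian_grad f (gf : E -> E) p (H : 'I_n -> E) v w :
  (forall x, grad_at f x (gf x)) ->
  (forall j, grad_at (fun x => gf x 0 j) p (H j)) ->
  hessian f p v w = \sum_j dot (H j) v * w 0 j.
Proof.
move=> fgf gfH; rewrite /hessian.
have -> : 'D_w f = fun x => dot (gf x) w by apply/funext => x; have [_ ->] := fgf x.
have [_ ->] := grad_at_sum (fun j => grad_atM (gfH j) (grad_at_cst (w 0 j) p)).
rewrite dot_suml; apply: eq_bigr => j _.
by rewrite scaler0 add0r dotZl mulrC.
Qed.

Lemma grad_at_sqnorm p : grad_at (fun p => dot p p) p (2 *: p).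
Proof.
apply: (grad_at_eq (grad_at_sum (fun i => grad_atM (grad_at_coord i p) (grad_at_coord i p)))).
rewrite [X in _ = 2 *: X]row_sum_delta scaler_sumr; apply: eq_bigr => i _.
by rewrite scalerA -scalerDl; congr (_ *: _); rewrite mulrDl mul1r.
Qed.

(** Differentiating first and recursing on the partial derivatives is what the
    product and chain rules call for; [partials] applies the derivatives in the
    opposite order. *)
Fixpoint Ck k f : Prop :=
  (forall x, differentiable f x) /\
  (if k is k'.+1 then forall i, Ck k' ('D_(delta_mx 0 i) f) else True).

Lemma Ck_diff k f x : Ck k f -> differentiable f x.
Proof. by case: k => [|k] []. Qed.

Lemma Ck_S k f : Ck k.+1 f -> Ck k f.
Proof.
elim: k f => [|k IH] f [df Df]; split=> // i; exact: IH.
Qed.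

(** A closed formula for the gradient replaces the partial derivatives; all the
    closure properties below come from it by induction on [k]. *)
Lemma CkP k f (d : E -> E) : (forall x, grad_at f x (d x)) ->
  (forall i, Ck k (fun x => d x 0 i)) -> Ck k.+1 f.
Proof.
move=> fd dk; split=> [x|i]; first by have [] := fd x.
suff -> : 'D_(delta_mx 0 i) f = fun x => d x 0 i by [].
by apply/funext => x; have [_ ->] := fd x; rewrite dotC dot_delta.
Qed.

Lemma Ck_cst k (c : R) : Ck k (fun=> c).
Proof.
elim: k c => [|k IH] c; first by split=> // x; exact: differentiable_cst.
apply: (CkP (fun x => grad_at_cst c x)) => i.
by under eq_fun do rewrite mxE.
Qed.

Lemma Ck_coord k i : Ck k (fun x => x 0 i).
Proof.
case: k => [|k]; first by split=> // x; exact: differentiable_coord.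
by apply: (CkP (grad_at_coord i)) => j; exact: Ck_cst.
Qed.

Lemma grad_at_self k f x : Ck k f ->
  grad_at f x (\row_i 'D_(delta_mx 0 i) f x).
Proof. by move=> /(Ck_diff x); exact: differentiable_grad_at. Qed.

Lemma CkD k f g : Ck k f -> Ck k g -> Ck k (fun x => f x + g x).
Proof.
elim: k f g => [|k IH] f g fk gk.
  by split=> // x; apply: differentiableD; [case: fk | case: gk].
apply: (CkP (fun x => grad_atD (grad_at_self x fk) (grad_at_self x gk))) => i.
under eq_fun do rewrite !mxE.
by apply: IH; [exact: (proj2 fk) | exact: (proj2 gk)].
Qed.

Lemma CkM k f g : Ck k f -> Ck k g -> Ck k (fun x => f x * g x).
Proof.
elim: k f g => [|k IH] f g fk gk.
  by split=> // x; apply: differentiableM; [case: fk | case: gk].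
apply: (CkP (fun x => grad_atM (grad_at_self x fk) (grad_at_self x gk))) => i.
under eq_fun do rewrite !mxE.
by apply: CkD; apply: IH; [exact: Ck_S| exact: (proj2 gk)
  | exact: Ck_S| exact: (proj2 fk)].
Qed.

Lemma Ck_sum k m (f : 'I_m -> E -> R) :
  (forall j : 'I_m, Ck k (f j)) -> Ck k (fun x => \sum_(j < m) f j x).
Proof.
elim: m f => [|m IH] f fk.
  by under eq_fun do rewrite big_ord0; exact: Ck_cst.
under eq_fun do rewrite big_ord_recr/=.
by apply: CkD => //; exact: IH.
Qed.

(** The induction needs all [N] at once, as the derivative of [flat N] involves
    [flat N.+1] and [flat N.+2]. *)
Lemma Ck_flat k N f : Ck k f -> Ck k (fun x => flat N (f x)).
Proof.
elim: k N f => [|k IH] N f fk.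
  split=> // x; have [//] := grad_at_comp (is_derive_flat N (f x)) (grad_at_self x fk).
apply: (CkP (fun x => grad_at_comp (is_derive_flat N (f x)) (grad_at_self x fk))) => i.
under eq_fun do rewrite !mxE -mulNr.
have fk' := Ck_S fk; apply: CkM; last exact: (proj2 fk).
apply: CkD; first exact: IH.
apply: CkM; [exact: Ck_cst | exact: IH].
Qed.

Definition smooth f := forall k, Ck k f.

Lemma smoothX f k : smooth f -> smooth (fun p => f p ^+ k).
Proof.
move=> fs j; elim: k => [|k IH]; first exact: Ck_cst.
by under eq_fun do rewrite exprS; exact: CkM.
Qed.

Lemma smooth_cut f : smooth f -> smooth (fun p => cut (f p)).
Proof.
move=> fs k; rewrite /cut; apply: CkM; first exact: Ck_cst.
apply: Ck_flat; under eq_fun do rewrite -mulNr.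
apply: CkD; [exact: Ck_cst | apply: CkM; first exact: Ck_cst].
apply: Ck_flat; apply: CkD; last exact: Ck_cst.
by apply: CkM; [exact: Ck_cst | exact: fs].
Qed.

Lemma partials_rcons s i f : partials (rcons s i) f = partials s ('D_(delta_mx 0 i) f).
Proof. by elim: s => //= j s ->. Qed.

Lemma smooth_partials s f x : smooth f -> differentiable (partials s f) x.
Proof.
move=> /(_ (size s)); elim/last_ind: s f => [|s i IH] f; first by move=> [df _]; exact: df.
by rewrite size_rcons partials_rcons => -[_ Df]; exact: (IH _ (Df i)).
Qed.

Lemma smooth_smooth_on_open W f : smooth f -> smooth_on_open W f.
Proof.
move=> fs s x _; have d := smooth_partials s x fs.
by split=> [|i]; [exact: differentiable_continuous | exact: diff_derivable].
Qed.

End SmoothFunctions.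

(** * Critical points do not depend on local extensions *)

Section CriticalPoints.
Variables (R : realType) (n : nat).
Local Notation E := 'rV[R]_n.
Implicit Types (f F : E -> R) (x v w p u : E) (i j : 'I_n).

Lemma smooth_dot : smooth (fun x : E => dot x x).
Proof. by move=> k; apply: Ck_sum => i; apply: CkM; exact: Ck_coord. Qed.

Lemma smooth_continuous F : smooth F -> continuous F.
Proof. by move=> /(_ 0%N)[dF _] x; exact: (differentiable_continuous (dF x)). Qed.

Lemma smooth_derive F i : smooth F -> smooth ('D_(delta_mx 0 i) F).
Proof. by move=> Fs k; exact: (proj2 (Fs k.+1) i). Qed.

Lemma open_dot_lt (r : R) : open [set x : E | dot x x < r].
Proof.
rewrite (_ : [set _ | _] = (fun x => dot x x) @^-1` [set t | t < r])//.
apply: open_comp; last exact: open_lt.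
by move=> x _; exact: smooth_continuous smooth_dot x.
Qed.

Lemma open_dot_gt (r : R) : open [set x : E | r < dot x x].
Proof.
rewrite (_ : [set _ | _] = (fun x => dot x x) @^-1` [set t | r < t])//.
apply: open_comp; last exact: open_gt.
by move=> x _; exact: smooth_continuous smooth_dot x.
Qed.

(** A local extension [g] at [x] agrees with [F] on the interior points [t x],
    [t < 1], close to [x]; the partial derivatives of both are continuous, so
    they also agree at [x]. *)
Lemma crit_extension (M O : set E) f F x : open O -> M = @unit_ball R n `&` O ->
  smooth F -> (forall y, M y -> F y = f y) ->
  crit M f x -> M x /\ forall v, 'D_v F x = 0.
Proof.
move=> oO ME Fs Ff [Mx [g [W [oW Wx gs gf] Dg]]]; split=> // v.
have [_ ->] := grad_at_self x (Fs 0%N).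
apply: big1 => i _; rewrite mxE; suff -> : 'D_(delta_mx 0 i) F x = 0 by rewrite mul0r.
apply/eqP/negPn/negP => DF.
pose D y := 'D_(delta_mx 0 i) F y - 'D_(delta_mx 0 i) g y.
have Dx : D x != 0 by rewrite /D Dg subr0.
have Dc : {for x, continuous D}.
  apply: continuousB; first exact: smooth_continuous (smooth_derive i Fs) x.
  by have [] := gs [:: i] x Wx.
have [Bx Ox] : @unit_ball R n x /\ O x by rewrite ME in Mx.
have xt : (fun t : R => t *: x) @ (1 : R) --> x.
  by rewrite -{2}(scale1r x); exact: scalel_continuous.
have nA : \forall y \near x, [/\ W y, O y & D y != 0].
  near=> y; split; near: y; [exact: open_nbhs_nbhs | exact: open_nbhs_nbhs |].
  exact: (cvgr_neq0 _ Dc Dx).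
have nt : \forall t \near (1 : R)^'-, [/\ W (t *: x), O (t *: x) & D (t *: x) != 0].
  by apply: cvg_within; exact: xt nA.
(* an interior point of M on the segment to x where the derivatives differ *)
near (1 : R)^'- => t.
have [Wt Ot /negP[]] : [/\ W (t *: x), O (t *: x) & D (t *: x) != 0].
  by near: t; exact: nt.
have t1 : t < 1 by near: t; exact: nbhs_left_lt.
have t0 : 0 < t by near: t; apply: nbhs_left_gt.
have nt1 : nbhs (t *: x) [set y : E | dot y y < 1].
  apply: open_nbhs_nbhs; split; first exact: open_dot_lt.
  rewrite /= dotZl dotZr mulrA.
  have /enorm_le1 xx := Bx.
  apply: (@le_lt_trans _ _ (t * t)); first by rewrite ler_piMr// mulr_ge0 ?ltW.
  by rewrite -(mulr1 1) ltr_pM ?ltW.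
rewrite /D subr_eq0; apply/eqP/near_eq_derive; near=> y.
have Wy : W y by near: y; exact: open_nbhs_nbhs.
have My : M y.
  rewrite ME; split; last by near: y; exact: open_nbhs_nbhs.
  by apply/enorm_le1/ltW; near: y; exact: nt1.
by rewrite (gf _ Wy My) Ff.
Unshelve. all: by end_near. Qed.

End CriticalPoints.

(** * Derivatives of restrictions to the sphere *)

Section SphereHessian.
Variables (R : realType) (n : nat).
Local Notation E := 'rV[R]_n.
Implicit Types (f F : E -> R) (x v w u : E) (i j : 'I_n).

(** Chain rule for a map [psi] given by its coordinates. *)
Lemma grad_at_compv f (psi : E -> E) x (e : E) (d : 'I_n -> E) :
  (forall j, grad_at (fun y => psi y 0 j) x (d j)) -> grad_at f (psi x) e ->
  grad_at (fun y => f (psi y)) x (\sum_j e 0 j *: d j).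
Proof.
move=> dpsi [df fe].
have Dpsi : differentiable psi x.
  have -> : psi = \sum_(j < n) (fun y => psi y 0 j *: (delta_mx 0 j : E)).
    by apply/funext => y; rewrite fct_sumE [LHS]row_sum_delta.
  apply: differentiable_sum => j; apply: differentiableZl.
  by have [] := dpsi j.
have dfpsi : differentiable (f \o psi) x by exact: differentiable_comp.
split=> // v.
rewrite deriveE// -[fun y => _]/(f \o psi) diff_comp//= -deriveE// fe.
rewrite [LHS](_ : _ = \sum_j e 0 j * ('d psi x v) 0 j)//.
rewrite /dot; under [RHS]eq_bigr do rewrite summxE mulr_suml.
rewrite exchange_big/=; apply: eq_bigr => j _.
under eq_bigr do rewrite mxE -mulrA.
rewrite -mulr_sumr; congr (_ * _).
have [dj dE] := dpsi j; rewrite -[RHS]/(dot (d j) v) -dE.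
have [dc cE] := grad_at_coord j (psi x).
rewrite (deriveE _ dj); have cpsi := diff_comp Dpsi dc.
transitivity ((fun z : E => z 0 j) ('d psi x v)) => //.
have -> : 'd (fun y => psi y 0 j) x v = 'd (fun z : E => z 0 j) (psi x) ('d psi x v).
  by rewrite -[RHS]/((_ \o _) v) -cpsi.
by rewrite -(deriveE _ dc) cE dot_delta.
Qed.

Variable p : E.
Hypothesis p1 : dot p p = 1.

Let s u := dot (p + u) (p + u).
Let nu (t : R) := (Num.sqrt t)^-1.

Let is_derive_nu (t : R) : 0 < t -> is_derive t (1 : R) nu (- 2^-1 * nu t ^+ 3).
Proof.
move=> t0.
have st0 : Num.sqrt t != 0 by rewrite sqrtr_eq0 -ltNge.
have H := @is_deriveV R Num.sqrt t _ 1 st0 (is_derive1_sqrt t0).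
apply: (is_derive_eq H); rewrite /nu /GRing.scale/= -!exprVn invfM; ring.
Qed.

Let grad_shift j u : grad_at (fun u => (p + u) 0 j) u (delta_mx 0 j).
Proof.
under eq_fun do rewrite mxE.
rewrite -[delta_mx _ _]add0r; apply: grad_atD; [exact: grad_at_cst|exact: grad_at_coord].
Qed.

Let grad_s u : grad_at s u (2 *: (p + u)).
Proof.
apply: (grad_at_eq (grad_at_sum
  (fun j => grad_atM (grad_shift j u) (grad_shift j u)))).
rewrite [X in _ = 2 *: X]row_sum_delta scaler_sumr; apply: eq_bigr => j _.
by rewrite scalerA -scalerDl; congr (_ *: _); rewrite mulrDl mul1r.
Qed.

(* sphere_param p u is N u *: (p + u) *)
Let N u := nu (s u).

Let grad_N u : 0 < s u -> grad_at N u (- N u ^+ 3 *: (p + u)).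
Proof.
move=> su; apply: (grad_at_eq (grad_at_comp (is_derive_nu su) (grad_s u))).
by rewrite scalerA; congr (_ *: _); rewrite /N; field.
Qed.

Let grad_dotw w u : grad_at (fun u => dot (p + u) w) u w.
Proof.
apply: (grad_at_eq (grad_at_sum
  (fun j => grad_atM (grad_shift j u) (grad_at_cst (w 0 j) u)))).
rewrite [RHS]row_sum_delta; apply: eq_bigr => j _.
by rewrite scaler0 add0r.
Qed.

Let s_near0 : \forall u \near (0 : E), 0 < s u.
Proof.
have [ds _] := grad_s 0; have := differentiable_continuous ds.
move=> /(_ [set t | 0 < t]); apply; apply: open_nbhs_nbhs; split; first exact: open_gt.
by rewrite /s addr0 /= p1.
Qed.

Let paramE u j : sphere_param p u 0 j = N u * (p + u) 0 j.
Proof. by rewrite mxE. Qed.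

Let grad_param u j : 0 < s u -> grad_at (fun u => sphere_param p u 0 j) u
  (N u *: delta_mx 0 j + (p + u) 0 j *: (- N u ^+ 3 *: (p + u))).
Proof.
move=> su; under eq_fun do rewrite paramE.
exact: grad_atM (grad_N su) (grad_shift j u).
Qed.

Let param_sphere u : 0 < s u -> dot (sphere_param p u) (sphere_param p u) = 1.
Proof.
move=> su; rewrite dotZl dotZr mulrA -invfM -expr2 sqr_sqrtr ?dot_ge0//.
by rewrite mulVf// gt_eqF.
Qed.

Let s0 : s 0 = 1. Proof. by rewrite /s addr0. Qed.
Let N0 : N 0 = 1. Proof. by rewrite /N s0 /nu sqrtr1 invr1. Qed.
Let param0 : sphere_param p 0 = p.
Proof. by apply/rowP => j; rewrite paramE N0 mul1r addr0. Qed.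

(* The smooth f is differentiated; F is the function studied, which need only
   agree with f on the sphere. *)
Variables (f F : E -> R) (gf : E -> E) (H : 'I_n -> E).
Hypothesis fF : forall x, dot x x = 1 -> F x = f x.
Hypothesis fgf : forall x, grad_at f x (gf x).
Hypothesis gfH : forall j, grad_at (fun x => gf x 0 j) p (H j).

Let derive_param u w : 0 < s u -> 'D_w (F \o sphere_param p) u =
  \sum_j gf (sphere_param p u) 0 j *
     (N u * w 0 j + (p + u) 0 j * (-1 * (N u * (N u * N u)) * dot (p + u) w)).
Proof.
move=> su; have Ff : \near u, (F \o sphere_param p) u = f (sphere_param p u).
  near=> z; rewrite /= fF// param_sphere//; near: z.
  have [ds _] := grad_s u; have := differentiable_continuous ds.
  by move=> /(_ [set t | 0 < t]); apply; apply: open_nbhs_nbhs; split; first exact: open_gt.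
rewrite (near_eq_derive _ Ff).
have [_ ->] := grad_at_compv (fun j => grad_param j su) (fgf (sphere_param p u)).
rewrite [LHS]/dot; under [LHS]eq_bigr do rewrite summxE mulr_suml.
rewrite exchange_big/=; apply: eq_bigr => j _.
under eq_bigr do rewrite mxE -mulrA.
rewrite -mulr_sumr; congr (_ * _).
rewrite -[LHS]/(dot _ w) [LHS]dotDl !dotZl dot_delta; ring.
Unshelve. all: by end_near. Qed.

Lemma sphere_derive v : dot p v = 0 ->
  'D_v (F \o sphere_param p) 0 = dot (gf p) v.
Proof.
move=> pv; rewrite derive_param ?s0 ?ltr01//; apply: eq_bigr => j _.
by rewrite param0 addr0 pv N0 !mulr0 addr0 mul1r.
Qed.

(** The Hessian form of the restriction is that of [f] corrected by the
    curvature of the sphere: in a tangent direction [w], [sphere_param p] has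
    differential [w], and its second derivative is [- (dot v w) p]. *)
Lemma sphere_hessian v w : dot p v = 0 -> dot p w = 0 ->
  hessian (F \o sphere_param p) 0 v w =
  \sum_j dot (H j) v * w 0 j - dot p (gf p) * dot v w.
Proof.
move=> pv pw; rewrite /hessian.
have eqD : \forall u \near (0 : E), 'D_w (F \o sphere_param p) u =
  \sum_j gf (sphere_param p u) 0 j *
     (N u * w 0 j + (p + u) 0 j * (-1 * (N u * (N u * N u)) * dot (p + u) w)).
  by near=> u; apply: derive_param; near: u; exact: s_near0.
rewrite (near_eq_derive _ eqD).
have s00 : 0 < s 0 by rewrite s0.
have gfH0 j : grad_at (fun x => gf x 0 j) (sphere_param p 0) (H j).
  by rewrite param0.
have gfparam j := grad_at_compv (fun j => grad_param j s00) (gfH0 j).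
have gN := grad_N s00; rewrite N0 expr1n addr0 scaleN1r in gN.
(* The gradient of N^3 matters only up to a factor dot p w, which is 0. *)
have gcube := grad_atM (grad_at_cst (-1) 0) (grad_atM gN (grad_atM gN gN)).
have gK j := grad_atD (grad_atM gN (grad_at_cst (w 0 j) 0))
  (grad_atM (grad_shift j 0) (grad_atM gcube (grad_dotw w 0))).
have [_ ->] := grad_at_sum (fun j => grad_atM (gfparam j) (gK j)).
rewrite dot_suml mulr_suml -sumrB; apply: eq_bigr => j _.
have -> : dot (H j) v = dot (\sum_i H j 0 i *:
    (N 0 *: delta_mx 0 i + (p + 0) 0 i *: (- N 0 ^+ 3 *: (p + 0)))) v.
  rewrite dot_suml; apply: eq_bigr => i _.
  by rewrite dotZl dotDl !dotZl dot_delta addr0 pv N0 !mulr0 addr0 mul1r.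
rewrite !(dotDl, dotZl, dot0l, dot_delta, dotNl) !addr0 pv pw N0 param0 (dotC w v); ring.
Unshelve. all: by end_near. Qed.

End SphereHessian.

(** * Index of a form of constant sign on two coordinate subspaces *)

Section FormIndex.
Variables (R : realType) (n : nat).
Local Notation E := 'rV[R]_n.

Definition restr (N : {set 'I_n}) (v : E) : 'rV[R]_#|N| :=
  \row_(j < #|N|) v 0 (enum_val j).

Fact restr_is_linear N : linear (restr N).
Proof. by move=> k v w; apply/rowP => j; rewrite !mxE. Qed.
HB.instance Definition _ N := GRing.isLinear.Build _ _ _ _ (restr N) (restr_is_linear N).

Lemma restr_ker N v : v \in lker (linfun (restr N)) ->
  forall i, i \in N -> v 0 i = 0.
Proof.
rewrite memv_ker lfunE => /eqP/rowP vN i iN.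
by have := vN (enum_rank_in iN i); rewrite !mxE enum_rankK_in.
Qed.

(** A negative definite subspace meets the vectors vanishing on [N] only in [0],
    so restriction to the coordinates in [N] is injective on it. *)
Lemma form_index_split (H : E -> E -> R) (N : {set 'I_n}) :
  (forall v : E, v != 0 -> (forall i, i \notin N -> v 0 i = 0) -> H v v < 0) ->
  (forall v : E, (forall i, i \in N -> v 0 i = 0) -> 0 <= H v v) ->
  form_index H #|N|.
Proof.
move=> Hneg Hpos.
have dimE : \dim {:E} = n by rewrite dimvf /dim/= mul1n.
have upper (V : {vspace E}) : negative_definite_on V H -> (\dim V <= #|N|)%N.
  move=> Vneg; set pi := linfun (restr N).
  have VK : (V :&: lker pi)%VS = 0%VS.
    apply/eqP; rewrite -subv0; apply/subvP => v; rewrite memv_cap => /andP[vV vK].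
    rewrite memv0; apply/negPn/negP => v0.
    by have := Vneg v vV v0; rewrite ltNge Hpos//; exact: restr_ker.
  have := limg_ker_dim pi V; rewrite VK dimv0 add0n => <-.
  by apply: leq_trans (dimvS (subvf _)) _; rewrite dimvf /dim/= mul1n.
split=> //; set pi := linfun (restr (~: N)); exists (lker pi).
  move=> v vK v0; apply: Hneg => // i iN.
  by apply: (restr_ker vK); rewrite inE.
apply/eqP; rewrite eqn_leq; apply/andP; split.
  apply: upper => v vK v0; apply: Hneg => // i iN.
  by apply: (restr_ker vK); rewrite inE.
have := limg_ker_dim pi fullv; rewrite capfv dimE => eqn.
have : (\dim (pi @: fullv) <= #|~: N|)%N.
  by apply: leq_trans (dimvS (subvf _)) _; rewrite dimvf /dim/= mul1n.
have := cardsC N; rewrite card_ord => cN le2.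
by rewrite -(leq_add2r #|~: N|) cN -[leqLHS]eqn leq_add2l.
Qed.

End FormIndex.

(** * The planar equations *)

Section PlanarModel.
Variable R : realType.
Implicit Types (x y X mu c t : R).

(** The cubic with [valley 0 = -1] and derivative
    [(2/5) (10 y - 1) (y + 1)]: it decreases from [-2/15] at [y = -1] to its
    minimum at [1/10], and vanishes before [7/10].  The minimum lies above the
    height [y = 0] of the critical point that must survive. *)
Definition valley y : R := 4 / 3 * y ^+ 3 + 9 / 5 * y ^+ 2 - 2 / 5 * y - 1.
Definition dvalley y : R := 4 * y ^+ 2 + 18 / 5 * y - 2 / 5.
Definition ddvalley y : R := 8 * y + 18 / 5.

(** The height is fixed by [dhill 0 = - dvalley 0], which puts a solution of the
    critical equations at [y = 0]; as [hill] starts only at [y = -1/10], its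
    slope is already much larger at [1/10]. *)
Definition hill_height : R := 4 / 5 / flat 2 (1 / 20).
Definition hill y : R := hill_height * flat 0 ((y + 1 / 10) / 2).
Definition dhill y : R := hill_height / 2 * flat 2 ((y + 1 / 10) / 2).
Definition ddhill y : R := hill_height / 4 *
  (flat 4 ((y + 1 / 10) / 2) - 2 * flat 3 ((y + 1 / 10) / 2)).

Lemma valley_lt0 y : -1 <= y -> y <= 1 / 10 -> valley y < 0.
Proof.
move=> y1 y2.
(* Taylor expansion at the critical point -1 *)
rewrite (_ : valley y = (y + 1) ^+ 2 * (4 / 3 * y - 13 / 15) - 2 / 15); last first.
  by rewrite /valley; field.
have : 0 <= (y + 1) ^+ 2 * (13 / 15 - 4 / 3 * y) by rewrite mulr_ge0 ?sqr_ge0; lra.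
lra.
Qed.

Lemma valley_ge y : 7 / 10 <= y -> 1 / 20 <= valley y.
Proof.
move=> y7; set t := y - 7 / 10; have t0 : 0 <= t by rewrite /t; lra.
have := exprn_ge0 3 t0; have := exprn_ge0 2 t0.
rewrite /valley (_ : y = t + 7 / 10); last by rewrite /t; ring.
nra.
Qed.

Lemma hill_height_gt0 : 0 < hill_height.
Proof. by rewrite /hill_height divr_gt0 ?flat_gt0//; lra. Qed.

Lemma hill_itv y : 0 <= hill y <= hill_height.
Proof.
have h0 := ltW hill_height_gt0.
rewrite /hill mulr_ge0 ?flat_ge0//= -[leRHS]mulr1 ler_wpM2l//.
exact: flat_le_fact.
Qed.

Lemma dhill_ge0 y : 0 <= dhill y.
Proof.
by apply: mulr_ge0; [apply: divr_ge0; rewrite // ltW// hill_height_gt0 | exact: flat_ge0].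
Qed.

Lemma hill_eq0 y : y <= - (1 / 10) -> hill y = 0 /\ dhill y = 0.
Proof. by move=> y0; rewrite /hill /dhill !flat_le0 ?mulr0//; lra. Qed.

Lemma dhill0 : dhill 0 = 2 / 5.
Proof.
rewrite /dhill /hill_height add0r (_ : 1 / 10 / 2 = 1 / 20); last by field.
have : flat 2 (1 / 20 : R) != 0 by rewrite gt_eqF// flat_gt0//; lra.
by move=> f0; field.
Qed.

Lemma dhill_homo x y : x <= y -> y <= 7 / 10 -> dhill x <= dhill y.
Proof.
move=> xy y7; have hh := hill_height_gt0.
by apply: ler_wpM2l; [lra | apply: flat2_homo; lra].
Qed.

(** The ratio of the slopes at [1/10] and [0] is [exp 10 / 4]; the crude bound
    [exp (5/2) >= 7/2] is enough. *)
Lemma dhill_large y : 1 / 10 <= y -> y <= 7 / 10 -> 10 <= dhill y.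
Proof.
move=> y1 y7; apply: le_trans (dhill_homo y1 y7).
rewrite /dhill /hill_height (_ : (1 / 10 + 1 / 10) / 2 = 1 / 10); last by field.
rewrite /flat !ifT; [|lra|lra].
rewrite (_ : (1 / 20)^-1 = 20 :> R); last by field.
rewrite (_ : (1 / 10)^-1 = 10 :> R); last by field.
rewrite -!exprVn (_ : (1 / 20)^-1 = 20 :> R); last by field.
rewrite (_ : (1 / 10)^-1 = 10 :> R); last by field.
rewrite (_ : expR (- 10) = expR (- 20) * expR (5 / 2) ^+ 4); last first.
  by rewrite -expRM_natl -expRD; congr expR; field.
have e20 : expR (- 20) != 0 :> R by rewrite gt_eqF// expR_gt0.
rewrite [X in _ <= X](_ : _ = 1 / 10 * expR (5 / 2) ^+ 4); last by field.
have e5 : 7 / 2 <= expR (5 / 2) :> R by apply: le_trans (expR_ge1Dx _); lra.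
have e25 : (7 / 2) ^+ 2 <= expR (5 / 2) ^+ 2 :> R by rewrite ler_pXn2r ?nnegrE//; lra.
rewrite (exprM _ 2 2); nra.
Qed.

Let is_derive_arg y : is_derive y (1 : R) (fun y => (y + 1 / 10) / 2) (1 / 2).
Proof.
have H := is_deriveM (is_deriveD (is_derive_id y (1 : R)) (is_derive_cst (1 / 10 : R) y 1))
  (is_derive_cst (2^-1 : R) y 1).
by apply: (is_derive_eq H); rewrite /GRing.scale/=; field.
Qed.

Lemma is_derive_hill y : is_derive y (1 : R) hill (dhill y).
Proof.
have H := is_deriveZ hill_height (@is_derive1_comp R (flat 0) _ y _ _
  (is_derive_flat 0 ((y + 1 / 10) / 2)) (is_derive_arg y)).
by apply: (is_derive_eq H); rewrite /dhill /GRing.scale/=; field.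
Qed.

Lemma is_derive_dhill y : is_derive y (1 : R) dhill (ddhill y).
Proof.
have H := is_deriveZ (hill_height / 2) (@is_derive1_comp R (flat 2) _ y _ _
  (is_derive_flat 2 ((y + 1 / 10) / 2)) (is_derive_arg y)).
by apply: (is_derive_eq H); rewrite /ddhill /GRing.scale/=; field.
Qed.

Lemma ddhill0 : 0 <= ddhill 0.
Proof.
have hh := hill_height_gt0; apply: mulr_ge0; first by lra.
rewrite add0r (_ : 1 / 10 / 2 = 1 / 20); last by field.
rewrite (flatS 3).
have := flat_ge0 4 (1 / 20 : R); lra.
Qed.

(** For [y >= 1/10] the hill is too steep.  Below, [valley] decreases, so
    [xi >= 0] and squaring turns the equations into
    [- valley y * (dvalley y)^2 = (dhill y)^2].  Both sides are [4/25] at [0];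
    the left one is above this value before [0] and below it after, the right one
    is nondecreasing; hence [y = 0]. *)
Lemma scaled_crit (xi y : R) : -1 < y ->
  xi ^+ 2 + valley y = 0 -> xi * dvalley y + dhill y = 0 -> y = 0 /\ xi = 1.
Proof.
move=> y1 eg eh.
have y7 : y < 7 / 10.
  by rewrite ltNge; apply/negP => /valley_ge; have := sqr_ge0 xi; lra.
have [y10|y10] := lerP (1 / 10) y.
  have := dhill_large y10 (ltW y7).
  have : -2 <= valley y by rewrite /valley; nra.
  have : 0 <= dvalley y <= 9 / 2 by rewrite /dvalley; apply/andP; split; nra.
  move=> /andP[d0 d1] g2 h10.
  have : -2 <= xi by nra.
  nra.
have dg0 : dvalley y < 0 by rewrite /dvalley; nra.
have [ym|ym] := lerP y (- (1 / 10)).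
  have [_ h0] := hill_eq0 ym; rewrite h0 addr0 in eh.
  have : xi = 0 by move/eqP: eh; rewrite mulf_eq0 (lt_eqF dg0) orbF => /eqP.
  by move=> xi0; have := valley_lt0 (ltW y1) (ltW y10); rewrite xi0 in eg; lra.
have eN : - valley y * dvalley y ^+ 2 = dhill y ^+ 2.
  have -> : dhill y = - (xi * dvalley y) by lra.
  have -> : valley y = - xi ^+ 2 by lra.
  by ring.
have h0 := dhill_ge0 y.
have y0 : y = 0.
  have [y0|y0|//] := ltgtP y 0.
  - have : dhill y <= 2 / 5 by rewrite -dhill0 dhill_homo//; lra.
    have : 4 / 25 < - valley y * dvalley y ^+ 2.
      have d1 : 2 / 5 * (1 - 8 * y) <= - dvalley y by rewrite /dvalley; nra.
      have d2 : 1 + 3 / 5 * y <= - valley y by rewrite /valley; nra.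
      have d3 : 4 / 25 * (1 - 8 * y) ^+ 2 <= dvalley y ^+ 2 by nra.
      have d4 : (1 + 3 / 5 * y) * (4 / 25 * (1 - 8 * y) ^+ 2) <= - valley y * dvalley y ^+ 2.
        by rewrite ler_pM//; nra.
      apply: lt_le_trans d4; nra.
    nra.
  - have : 2 / 5 <= dhill y by rewrite -dhill0 dhill_homo//; lra.
    have : - valley y * dvalley y ^+ 2 < 4 / 25.
      have d1 : - dvalley y <= 2 / 5 * (1 - 9 * y) by rewrite /dvalley; nra.
      have d2 : - valley y <= 1 + 2 / 5 * y by rewrite /valley; nra.
      have d3 : dvalley y ^+ 2 <= 4 / 25 * (1 - 9 * y) ^+ 2 by nra.
      have d4 : - valley y * dvalley y ^+ 2 <= (1 + 2 / 5 * y) * (4 / 25 * (1 - 9 * y) ^+ 2).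
        by rewrite ler_pM ?sqr_ge0//; have := valley_lt0 (ltW y1) (ltW y10); lra.
      apply: le_lt_trans d4 _; nra.
    nra.
split=> //; move: eh; rewrite y0 dhill0 /dvalley; lra.
Qed.

Lemma inv_sqr_ge (a : R) : 0 < a -> a <= 1 / 100 -> 100 * 100 <= a ^- 2.
Proof.
move=> a0 a1; have H : 100 <= a^-1 by rewrite -[100]invrK lef_pV2 ?posrE//; lra.
by rewrite -exprVn expr2 ler_pM.
Qed.

(** Here [X] is the sheared first coordinate and [r] the argument of the cutoff.
    Where the cutoff is constant the equations rescale to those of
    [scaled_crit].  In the region [r > 1/2] the first equation fails: either
    [y >= 7/10] and [valley] is positive, or [|X| >= 1/10] and [X^2 / a^2] is
    huge.  Below [y = -1/10] there is no hill, whatever the cutoff. *)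
Lemma planar_crit (a sg X y : R) : sg ^+ 2 = 1 -> 0 < a -> a <= 1 / 100 ->
  a * hill_height * (64 * expR 1) <= 1 / 100 -> -1 < y ->
  let r := X ^+ 2 + y ^+ 2 in
  a ^- 2 * X ^+ 2 + valley y + sg * a * hill y * (dcut r * (2 * X)) = 0 ->
  X * dvalley y + sg * a * (dhill y * cut r + hill y * (dcut r * (2 * y))) = 0 ->
  X = sg * a /\ y = 0.
Proof.
move=> sg1 a0 a1 aK y1 r e1 e2.
have an0 : a != 0 by rewrite gt_eqF.
have sgn0 : sg != 0 by rewrite -sqrf_eq0 sg1 oner_eq0.
have norm_sg : `|sg| = 1 by apply/eqP; rewrite -sqrp_eq1// real_normK ?num_real// sg1.
have c0 := inv_sqr_ge a0 a1.
have [ym|ym] := lerP y (- (1 / 10)).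
  have [b0 h0] := hill_eq0 ym.
  rewrite b0 h0 !mul0r addr0 mulr0 addr0 in e2.
  have dg0 : dvalley y < 0 by rewrite /dvalley; nra.
  have X0 : X = 0 by move/eqP: e2; rewrite mulf_eq0 (lt_eqF dg0) orbF => /eqP.
  have g0 : valley y < 0 by apply: valley_lt0; lra.
  by rewrite X0 b0 in e1; lra.
have [r12|r12] := leP r (1 / 2).
  rewrite dcut_eq0// cut1// in e1 e2.
  have xi1 : (sg * X / a) ^+ 2 + valley y = 0.
    rewrite -[RHS]e1 mul0r mulr0 addr0 !exprMn sg1 exprVn; ring.
  have xi2 : sg * X / a * dvalley y + dhill y = 0.
    have : sg * a * (sg * X / a * dvalley y + dhill y) = 0.
      transitivity (sg ^+ 2 * (X * dvalley y) + sg * a * dhill y); first by field.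
      by rewrite sg1 -[RHS]e2; ring.
    by move/eqP; rewrite !mulf_eq0 (negbTE sgn0) (negbTE an0) => /eqP.
  have [y0 xi] := scaled_crit y1 xi1 xi2; split=> //.
  have -> : X = sg ^+ 2 * X by rewrite sg1 mul1r.
  by rewrite -[sg in RHS]mulr1 -xi; field.
exfalso.
have small : `|sg * a * hill y * (dcut r * (2 * X))| <= 1 / 50 * `|X|.
  have := dcut_bound r; have := hill_itv y.
  move: (hill y) (dcut r) => B D /andP[B0 B1] D1.
  rewrite !normrM norm_sg mul1r (gtr0_norm a0) (ger0_norm (_ : 0 <= 2))//.
  rewrite (ger0_norm B0); have := normr_ge0 D; have := normr_ge0 X.
  move: `|X| `|D| D1 => Y {}D D1 Y0 D0.
  have H : a * B * D <= 1 / 100.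
    apply: le_trans aK; have {}a0 := ltW a0.
    by apply: ler_pM => //; [rewrite mulr_ge0 | rewrite ler_pM].
  nra.
have {}small : - (1 / 50 * `|X|) <= sg * a * hill y * (dcut r * (2 * X)).
  by rewrite lerNl; apply: le_trans small; rewrite -normrN ler_norm.
have X2 : X ^+ 2 = `|X| ^+ 2 by rewrite real_normK ?num_real.
have e3 : a ^- 2 * `|X| ^+ 2 + valley y <= 1 / 50 * `|X| by rewrite -X2; lra.
have Y0 := normr_ge0 X.
have e4 : 100 * 100 * `|X| ^+ 2 <= a ^- 2 * `|X| ^+ 2 by rewrite ler_wpM2r ?sqr_ge0.
have [y7|y7] := lerP (7 / 10) y.
  have := valley_ge y7; nra.
have : 1 / 10 <= `|X|.
  have : 1 / 100 <= `|X| ^+ 2 by rewrite -X2; rewrite /r in r12; nra.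
  nra.
have : -2 <= valley y by rewrite /valley; nra.
nra.
Qed.

Lemma valley_bound y : -1 <= y -> y <= 1 -> `|valley y| <= 5.
Proof. by move=> *; rewrite ler_norml /valley; apply/andP; split; nra. Qed.

Lemma dvalley_bound y : -1 <= y -> y <= 1 -> `|dvalley y| <= 8.
Proof. by move=> *; rewrite ler_norml /dvalley; apply/andP; split; nra. Qed.

Lemma ddvalley_bound y : -1 <= y -> y <= 1 -> `|ddvalley y| <= 12.
Proof. by move=> *; rewrite ler_norml /ddvalley; apply/andP; split; nra. Qed.

Lemma circle_mu (c x y mu : R) : 0 <= c -> x ^+ 2 + y ^+ 2 = 1 ->
  c * x ^+ 2 + valley y = mu * x -> x * dvalley y = mu * y -> `|mu| <= c + 13.
Proof.
move=> c0 r1 e1 e2.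
have -> : mu = c * (x * x ^+ 2) + (x * valley y + y * x * dvalley y).
  rewrite (_ : mu = mu * (x ^+ 2 + y ^+ 2)); last by rewrite r1 mulr1.
  transitivity (x * (mu * x) + y * (mu * y)); first by ring.
  by rewrite -e1 -e2; ring.
have [y1 y2] : -1 <= y /\ y <= 1 by split; nra.
have x1 : `|x| <= 1 by rewrite ler_norml; apply/andP; split; nra.
have y1' : `|y| <= 1 by rewrite ler_norml y1.
have x2 : x ^+ 2 <= 1 by have := sqr_ge0 y; lra.
have gb := valley_bound y1 y2; have dgb := dvalley_bound y1 y2.
apply: le_trans (ler_normD _ _) _; apply: lerD.
  rewrite normrM normrM (ger0_norm c0) (ger0_norm (sqr_ge0 x)) -[leRHS]mulr1 ler_wpM2l//.
  by rewrite -[leRHS]mulr1 ler_pM ?sqr_ge0.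
apply: le_trans (ler_normD _ _) _; rewrite !normrM (_ : 13 = 1 * 5 + 1 * 1 * 8); last by ring.
by apply: lerD; rewrite !ler_pM ?mulr_ge0.
Qed.

(** The expression is the Hessian form of the restriction to the circle in the
    tangent direction [(-y, x)], and equals [x] times [c (3 y^2 - 1)] up to
    bounded terms.  Eliminating [mu] bounds [c x^2 y], so that for large [c] a
    critical point has [y] close to [0] or to [1] or [-1], far from the zeros of
    [3 y^2 - 1]. *)
Lemma circle_nondeg (c x y mu : R) : 100 * 100 <= c -> x ^+ 2 + y ^+ 2 = 1 ->
  c * x ^+ 2 + valley y = mu * x -> x * dvalley y = mu * y ->
  (2 * c * x - mu) * y ^+ 2 - 2 * (dvalley y * x * y) + (x * ddvalley y - mu) * x ^+ 2 != 0.
Proof.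
move=> c0 r1 e1 e2.
have [y1 y2] : -1 <= y /\ y <= 1 by split; nra.
have xn0 : x != 0.
  apply/negP => /eqP x0; move: e1; rewrite x0 expr0n mulr0 mulr0 add0r => g0.
  have : (y - 1) * (y + 1) = 0 by move: r1; rewrite x0; lra.
  move/eqP; rewrite mulf_eq0 subr_eq0 addr_eq0 => /orP[] /eqP yE.
    have : 1 / 20 <= valley y by apply: valley_ge; lra.
    lra.
  have : valley y < 0 by apply: valley_lt0; lra.
  lra.
have -> : (2 * c * x - mu) * y ^+ 2 - 2 * (dvalley y * x * y) + (x * ddvalley y - mu) * x ^+ 2 =
   x * (c * (3 * y ^+ 2 - 1) - (3 * (y * dvalley y) - x ^+ 2 * ddvalley y + valley y)).
  transitivity (2 * c * x * y ^+ 2 - 2 * (dvalley y * x * y) + x * ddvalley y * x ^+ 2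
    - x * (mu * x) - y * (mu * y)); first by ring.
  rewrite -e1 -e2 (_ : x ^+ 2 = 1 - y ^+ 2); last by lra.
  by ring.
rewrite mulf_neq0// subr_eq0; apply/negP => /eqP eqc.
have cross : c * (x ^+ 2 * y) = x ^+ 2 * dvalley y - y * valley y.
  have : x * (mu * y) - y * (mu * x) = 0 by ring.
  by rewrite -e1 -e2; lra.
have := valley_bound y1 y2; have := dvalley_bound y1 y2; have := ddvalley_bound y1 y2.
move: (valley y) (dvalley y) (ddvalley y) cross eqc => G D H cross eqc.
rewrite !ler_norml => /andP[H1 H2] /andP[D1 D2] /andP[G1 G2].
have x2E : x ^+ 2 = 1 - y ^+ 2 by lra.
have x21 : 0 <= x ^+ 2 <= 1 by rewrite sqr_ge0 x2E; have := sqr_ge0 y; lra.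
have /andP[b1 b2] : - 13 <= c * (x ^+ 2 * y) <= 13.
  by rewrite cross; apply/andP; split; nra.
have /andP[b3 b4] : - 41 <= c * (3 * y ^+ 2 - 1) <= 41.
  by rewrite eqc; apply/andP; split; nra.
have u1 : 3 * y ^+ 2 - 1 <= 1 / 100 by nra.
have u2 : - (1 / 100) <= 3 * y ^+ 2 - 1 by nra.
have v1 : x ^+ 2 * y <= 1 / 100 by nra.
have v2 : - (1 / 100) <= x ^+ 2 * y by nra.
have w1 : 1 / 2 <= x ^+ 2 by lra.
have w2 : y <= 1 / 50 by nra.
have w3 : - (1 / 50) <= y by nra.
nra.
Qed.

End PlanarModel.

(** * The two extensions *)

Section Model.
Variables (R : realType) (m : nat).
Local Notation n := m.+2.
Local Notation E := 'rV[R]_n.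
Local Notation i0 := (ord0 : 'I_n).
Local Notation i1 := (lift ord0 ord0 : 'I_n).
Local Notation "'d_ i" := (delta_mx 0 i : E) (at level 8, i at level 2, format "''d_' i").
Implicit Types (p v w : E) (X K : E -> R).

Variables (a : R) (e : 'I_n -> R).
Hypotheses (a_gt0 : 0 < a) (a_le : a <= 1 / 100).
Hypothesis a_hill : a * hill_height R * (64 * expR 1) <= 1 / 100.
Hypothesis a_cut : a * (64 * expR 1) <= 1 / 100.
Hypotheses (e0 : e i0 = 0) (e1 : e i1 = 0).
Hypothesis e_large : forall i, i != i0 -> i != i1 -> a ^- 2 + 100 <= `|e i|.
Hypothesis e_inj : forall i j, i != i0 -> i != i1 -> j != i0 -> j != i1 -> e i = e j -> i = j.

Definition quad p : R := \sum_i e i * (p 0 i * p 0 i).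

(** All the functions considered have this shape: [X] is the first coordinate,
    possibly sheared, and [K] is the weight of the hill. *)
Definition profile (sg : R) X K p : R :=
  a ^- 2 / 3 * X p ^+ 3 + X p * valley (p 0 i1) + sg * a * (hill (p 0 i1) * K p) + quad p.

Definition shear sg p : R := p 0 i0 + sg * a * cut (dot p p).
(** The cutoff is evaluated at the squared norm of the sheared point. *)
Definition bump sg p : R := cut (shear sg p * shear sg p + (dot p p - p 0 i0 * p 0 i0)).

(** The functions [base], near the sphere, and [germ], near the origin, have a
    constant shift and a constant weight, and so share their derivatives. *)
Definition straight sg s k : E -> R := profile sg (fun p => p 0 i0 + s) (fun=> k).
Definition base : E -> R := straight 0 0 0.
Definition germ sg : E -> R := straight sg (sg * a) 1.
Definition model sg : E -> R := profile sg (shear sg) (bump sg).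

Lemma smooth_hill : smooth (fun p => hill (p 0 i1)).
Proof.
move=> k; rewrite /hill; apply: CkM; first exact: Ck_cst.
apply: Ck_flat; apply: CkM; last exact: Ck_cst.
by apply: CkD; [exact: Ck_coord | exact: Ck_cst].
Qed.

Lemma smooth_valley : smooth (fun p => valley (p 0 i1)).
Proof.
have yX k : smooth (fun p => p 0 i1 ^+ k) by apply: smoothX => j; exact: Ck_coord.
move=> k; rewrite /valley; apply: CkD; last exact: Ck_cst.
under eq_fun do rewrite -mulNr.
apply: CkD; [apply: CkD|]; apply: CkM; try exact: Ck_cst; try exact: Ck_coord; exact: yX.
Qed.

Lemma smooth_profile sg X K : smooth X -> smooth K -> smooth (profile sg X K).
Proof.
move=> Xs Ks k; rewrite /profile; apply: CkD; last first.
  by apply: Ck_sum => i; apply: CkM; [exact: Ck_cst | apply: CkM; exact: Ck_coord].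
apply: CkD; last first.
  apply: CkM; first exact: Ck_cst.
  by apply: CkM; [exact: smooth_hill | exact: Ks].
apply: CkD; apply: CkM; [exact: Ck_cst| exact: smoothX | exact: Xs | exact: smooth_valley].
Qed.

Lemma smooth_straight sg s k : smooth (straight sg s k).
Proof.
apply: smooth_profile => j; last exact: Ck_cst.
by apply: CkD; [exact: Ck_coord | exact: Ck_cst].
Qed.

Lemma smooth_shear sg : smooth (shear sg).
Proof.
move=> k; apply: CkD; first exact: Ck_coord.
by apply: CkM; [exact: Ck_cst | apply: smooth_cut; exact: smooth_dot].
Qed.

Lemma smooth_model sg : smooth (model sg).
Proof.
have Ss := smooth_shear sg; apply: smooth_profile => //; apply: smooth_cut => k.
apply: CkD; first by apply: CkM; exact: Ss.
apply: CkD; first exact: smooth_dot.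
under eq_fun do rewrite -mulN1r; apply: CkM; first exact: Ck_cst.
by apply: CkM; exact: Ck_coord.
Qed.

Lemma is_derive_valley y : is_derive y (1 : R) (@valley R) (dvalley y).
Proof.
have di := is_derive_id y (1 : R).
have d3 := is_deriveX 3 di; have d2 := is_deriveX 2 di.
have H := is_deriveB (is_deriveB (is_deriveD (is_deriveZ (4 / 3) d3) (is_deriveZ (9 / 5) d2))
   (is_deriveZ (2 / 5) di)) (is_derive_cst (1 : R) y (1 : R)).
rewrite !exprfctE in H.
by apply: (is_derive_eq H); rewrite /dvalley /GRing.scale/=; field.
Qed.

Lemma grad_at_profile sg X K p dX dK : grad_at X p dX -> grad_at K p dK ->
  grad_at (profile sg X K) p
   ((a ^- 2 * X p ^+ 2 + valley (p 0 i1)) *: dX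
    + (X p * dvalley (p 0 i1) + sg * a * (dhill (p 0 i1) * K p)) *: 'd_i1
    + (sg * a * hill (p 0 i1)) *: dK + \row_i (2 * e i * p 0 i)).
Proof.
move=> gX gK.
have gy := grad_at_coord i1 p.
have d3 : is_derive (X p) (1 : R) (fun t => t ^+ 3) (3 * X p ^+ 2).
  have H := is_deriveX 3 (is_derive_id (X p) (1 : R)); rewrite exprfctE in H.
  by apply: (is_derive_eq H); rewrite /GRing.scale/= mulr1.
have gQ : grad_at quad p (\row_i (2 * e i * p 0 i)).
  apply: (grad_at_eq (grad_at_sum (fun i => grad_atM (grad_at_cst (e i) p)
     (grad_atM (grad_at_coord i p) (grad_at_coord i p))))).
  rewrite [RHS]row_sum_delta; apply: eq_bigr => i _.
  by rewrite scaler0 addr0 -scalerDl scalerA mxE; congr (_ *: _); ring.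
have H := grad_atD (grad_atD (grad_atD
   (grad_atM (grad_at_cst (a ^- 2 / 3) p) (grad_at_comp d3 gX))
   (grad_atM gX (grad_at_comp (is_derive_valley (p 0 i1)) gy)))
   (grad_atM (grad_at_cst (sg * a) p)
     (grad_atM (grad_at_comp (is_derive_hill (p 0 i1)) gy) gK))) gQ.
apply: (grad_at_eq H); congr (_ + _); apply/rowP => i; rewrite !mxE.
by field; rewrite gt_eqF.
Qed.

Lemma grad_at_shear sg p :
  grad_at (shear sg) p ('d_i0 + (2 * sg * a * dcut (dot p p)) *: p).
Proof.
have H := grad_atD (grad_at_coord i0 p) (grad_atM (grad_at_cst (sg * a) p)
  (@grad_at_comp R n (@cut R) (fun p => dot p p) p _ _
     (is_derive_cut (dot p p)) (grad_at_sqnorm p))).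
apply: (grad_at_eq H).
by rewrite scaler0 addr0 !scalerA; congr (_ + _ *: _); ring.
Qed.

Let arg sg p := shear sg p * shear sg p + (dot p p - p 0 i0 * p 0 i0).

Lemma grad_at_bump sg p dX : grad_at (shear sg) p dX ->
  grad_at (bump sg) p (dcut (arg sg p) *:
    ((2 * shear sg p) *: dX + 2 *: p - (2 * p 0 i0) *: 'd_i0)).
Proof.
move=> gX; have gx := grad_at_coord i0 p.
have H := grad_atD (grad_atM gX gX)
  (grad_atD (grad_at_sqnorm p) (grad_atM (grad_at_cst (-1) p) (grad_atM gx gx))).
have eqa : (fun p => shear sg p * shear sg p + (dot p p + -1 * (p 0 i0 * p 0 i0))) = arg sg.
  by apply/funext => q; rewrite /arg mulN1r.
rewrite eqa in H.
apply: (grad_at_eq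
  (@grad_at_comp R n (@cut R) (arg sg) p _ _ (is_derive_cut (arg sg p)) H)).
congr (_ *: _).
by apply/rowP => i; rewrite !mxE; ring.
Qed.

Lemma modelE_far sg p : 3 / 4 <= dot p p -> model sg p = base p.
Proof.
move=> p34; rewrite /model /base /straight /profile addr0.
have shE : shear sg p = p 0 i0 by rewrite /shear cut0// mulr0 addr0.
have bE : bump sg p = 0 by rewrite /bump shE addrCA subrr addr0 cut0.
by rewrite shE bE !mulr0.
Qed.

(** The shear moves [p] by at most [1/100], so the hill is still at full
    weight. *)
Lemma modelE_near sg p : sg ^+ 2 = 1 -> dot p p < 1 / 4 -> model sg p = germ sg p.
Proof.
move=> sg1 p4; rewrite /model /germ /straight /profile.
have shE : shear sg p = p 0 i0 + sg * a by rewrite /shear cut1 ?mulr1//; lra.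
rewrite shE /bump shE cut1//.
have x2 := coord_sqr_le i0 p.
have sga : (sg * a) ^+ 2 <= 1 / 100 by rewrite exprMn sg1 mul1r; have := a_gt0; have := a_le; nra.
set x := p 0 i0 in x2 *; set t := sg * a in sga *.
have : 2 * (x * t) <= 4 * t ^+ 2 + x ^+ 2 / 4 by have := sqr_ge0 (2 * t - x / 2); nra.
nra.
Qed.

Lemma dot_planar p v : (forall i, i != i0 -> i != i1 -> p 0 i = 0) ->
  dot p v = p 0 i0 * v 0 i0 + p 0 i1 * v 0 i1.
Proof.
move=> pz; rewrite /dot (bigD1 i0)//= (bigD1 i1)//= big1 ?addr0// => i /andP[ni0 ni1].
by rewrite pz// mul0r.
Qed.

(** Up to the invertible factor [1 + D x] of the shear, the gradient is that of
    the unsheared function at the sheared point: the entry along [x] gives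
    [S = 0], after which the shear disappears from the other entries.  A solution
    is then the point [X = sg * a], [y = 0] of [planar_crit]. *)
Lemma crit_model sg p : sg ^+ 2 = 1 -> dot p p <= 1 ->
  (forall v, 'D_v (model sg) p = 0) -> p = 0.
Proof.
move=> sg1 p1 Dp.
have gX := grad_at_shear sg p.
have G0 := grad_at_crit (grad_at_profile sg gX (grad_at_bump gX)) Dp.
have Gi i := congr1 (fun q : E => q 0 i) G0.
have norm_sg : `|sg| = 1 by apply/eqP; rewrite -sqrp_eq1// real_normK ?num_real// sg1.
set x : R := p 0 i0; set y : R := p 0 i1; set X : R := shear sg p.
set C := sg * a * hill y * dcut (arg sg p).
set S := a ^- 2 * X ^+ 2 + valley y + 2 * X * C.
set D := 2 * sg * a * dcut (dot p p).
have x2 : x ^+ 2 <= 1 := le_trans (coord_sqr_le i0 p) p1.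
have y2 : y ^+ 2 <= 1 := le_trans (coord_sqr_le i1 p) p1.
have D_small : `|D * x| <= 1 / 50.
  have x1 : `|x| <= 1 by rewrite ler_norml; apply/andP; split; nra.
  have := dcut_bound (dot p p); rewrite /D; move: (dcut _) => d d1.
  rewrite !normrM norm_sg (gtr0_norm a_gt0) ger0_norm// mulr1 -mulrA -mulrA.
  have : `|d| * `|x| <= 64 * expR 1 by rewrite -[leRHS]mulr1 ler_pM.
  move=> /(ler_wpM2l (ltW a_gt0)); have := a_cut; lra.
have C_small : `|C| <= 1 / 100.
  have /andP[h0 h1] := hill_itv y; have := dcut_bound (arg sg p); rewrite /C.
  move: (hill y) (dcut _) h0 h1 => h d h0 h1 d1.
  have -> : `|sg * a * h * d| = a * h * `|d|.
    by rewrite !normrM norm_sg (gtr0_norm a_gt0) (ger0_norm h0) mul1r.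
  apply: le_trans a_hill; have {}a0 := ltW a_gt0.
  by apply: ler_pM => //; [rewrite mulr_ge0 | rewrite ler_pM].
have S0 : S = 0.
  have : S * (1 + D * x) = 0.
    by have := Gi i0; rewrite !mxE /= e0 => <-; rewrite /S /C /D /X /x /y; ring.
  move/eqP; rewrite mulf_eq0 => /orP[/eqP//|/eqP Dx].
  have Dx' : D * x = -1 by lra.
  by move: D_small; rewrite Dx' normrN1; lra.
have T0 : X * dvalley y + sg * a * (dhill y * bump sg p) + 2 * C * y = 0.
  transitivity (S * (D * y) + (X * dvalley y + sg * a * (dhill y * bump sg p) + 2 * C * y)).
    by rewrite S0 mul0r add0r.
  by have := Gi i1; rewrite !mxE /= e1 => <-; rewrite /S /C /D /X /x /y; ring.
have z0 i : i != i0 -> i != i1 -> p 0 i = 0.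
  move=> ni0 ni1; have : (C + e i) * p 0 i = 0.
    have : S * (D * p 0 i) + 2 * ((C + e i) * p 0 i) = 0.
      have := Gi i; rewrite !mxE /= (negbTE ni0) (negbTE ni1) !mulr0n => <-.
      by rewrite /S /C /D /X /x /y; ring.
    by rewrite S0; lra.
  move/eqP; rewrite mulf_eq0 => /orP[|/eqP//]; rewrite addr_eq0 => /eqP CE.
  have := e_large ni0 ni1; rewrite -normrN -CE.
  have : 0 <= a ^- 2 by rewrite invr_ge0 sqr_ge0.
  lra.
have ppE : dot p p = x * x + y * y by exact: dot_planar.
have argE : arg sg p = X ^+ 2 + y ^+ 2 by rewrite /arg ppE /X /x /y; ring.
have [Xa y0] : X = sg * a /\ y = 0.
  apply: planar_crit; rewrite -?argE //.
  (* the lowest point of the disc, where dvalley vanishes *)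
  - have : -1 <= y by nra.
    rewrite le_eqVlt => /orP[/eqP y1|//]; exfalso.
    have x0 : x = 0 by apply/eqP; rewrite -sqrf_eq0 expr2; apply/eqP; nra.
    have X0 : X = 0 by rewrite /X /shear cut0 ?mulr0 ?addr0// ppE -y1; nra.
    have : valley y < 0 by apply: valley_lt0; lra.
    by move: S0; rewrite /S X0; lra.
  - by rewrite -[RHS]S0 /S /C; ring.
  - by rewrite -[RHS]T0 /C /bump -/(arg sg p); ring.
(* |x| is at most a, so p lies where the shear is the translation by sg * a *)
have x0 : x = 0.
  have : x = sg * a * (1 - cut (dot p p)).
    by rewrite -[LHS](addrK (sg * a * cut (dot p p))) -[x + _]/X Xa; ring.
  have [c0 c1] := andP (cut_itv (dot p p)) => xE.
  have xa : x ^+ 2 <= a ^+ 2.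
    rewrite xE !exprMn sg1 mul1r -[leRHS]mulr1 ler_wpM2l ?sqr_ge0//; nra.
  by rewrite xE cut1 ?subrr ?mulr0// ppE y0; have := a_gt0; have := a_le; nra.
apply/rowP => i; rewrite mxE.
by have [->|ni0] := eqVneq i i0; [|have [->|ni1] := eqVneq i i1; [|exact: z0]].
Qed.

Section Straight.
Variables (sg s k : R).

Definition straight_grad p : E := \row_j
  ((a ^- 2 * (p 0 i0 + s) ^+ 2 + valley (p 0 i1)) * (j == i0)%:R
   + ((p 0 i0 + s) * dvalley (p 0 i1) + sg * a * (dhill (p 0 i1) * k)) * (j == i1)%:R
   + 2 * e j * p 0 j).

Definition straight_hess p j : E :=
  (j == i0)%:R *: ((2 * a ^- 2 * (p 0 i0 + s)) *: 'd_i0 + dvalley (p 0 i1) *: 'd_i1)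
  + (j == i1)%:R *: (dvalley (p 0 i1) *: 'd_i0
      + ((p 0 i0 + s) * ddvalley (p 0 i1) + sg * a * (ddhill (p 0 i1) * k)) *: 'd_i1)
  + (2 * e j) *: 'd_j.

Lemma is_derive_dvalley y : is_derive y (1 : R) (@dvalley R) (ddvalley y).
Proof.
have di := is_derive_id y (1 : R).
have d2 := is_deriveX 2 di.
have H := is_deriveB (is_deriveD (is_deriveZ 4 d2) (is_deriveZ (18 / 5) di))
   (is_derive_cst (2 / 5 : R) y (1 : R)).
rewrite !exprfctE in H.
by apply: (is_derive_eq H); rewrite /ddvalley /GRing.scale/=; field.
Qed.

Let grad_at_X p : grad_at (fun p : E => p 0 i0 + s) p 'd_i0.
Proof. by have := grad_atD (grad_at_coord i0 p) (grad_at_cst s p); rewrite addr0. Qed.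

Lemma grad_at_straight p : grad_at (straight sg s k) p (straight_grad p).
Proof.
apply: (grad_at_eq (grad_at_profile sg (grad_at_X p) (grad_at_cst k p))).
by apply/rowP => j; rewrite !mxE eqxx /=; ring.
Qed.

Lemma grad_at_straight_grad p j :
  grad_at (fun p => straight_grad p 0 j) p (straight_hess p j).
Proof.
have gy := grad_at_coord i1 p; have gX := grad_at_X p.
have d2 : is_derive (p 0 i0 + s) (1 : R) (fun t => t ^+ 2) (2 * (p 0 i0 + s)).
  have H := is_deriveX 2 (is_derive_id (p 0 i0 + s) (1 : R)); rewrite exprfctE in H.
  by apply: (is_derive_eq H); rewrite /GRing.scale/= mulr1.
have H := grad_atD (grad_atD
  (grad_atM (grad_atD (grad_atM (grad_at_cst (a ^- 2) p) (grad_at_comp d2 gX))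
     (grad_at_comp (is_derive_valley (p 0 i1)) gy)) (grad_at_cst (j == i0)%:R p))
  (grad_atM (grad_atD (grad_atM gX (grad_at_comp (is_derive_dvalley (p 0 i1)) gy))
     (grad_atM (grad_at_cst (sg * a) p) (grad_atM
       (grad_at_comp (is_derive_dhill (p 0 i1)) gy) (grad_at_cst k p))))
     (grad_at_cst (j == i1)%:R p)))
  (grad_atM (grad_at_cst (2 * e j) p) (grad_at_coord j p)).
under eq_fun do rewrite mxE.
apply: (grad_at_eq H); apply/rowP => i; rewrite !mxE; ring.
Qed.

Lemma dot_straight_hess p j v : dot (straight_hess p j) v =
  (j == i0)%:R * (2 * a ^- 2 * (p 0 i0 + s) * v 0 i0 + dvalley (p 0 i1) * v 0 i1)
  + (j == i1)%:R * (dvalley (p 0 i1) * v 0 i0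
      + ((p 0 i0 + s) * ddvalley (p 0 i1) + sg * a * (ddhill (p 0 i1) * k)) * v 0 i1)
  + 2 * e j * v 0 j.
Proof. by rewrite !(dotDl, dotZl, dot_delta). Qed.

Lemma hessian_straight p v w : hessian (straight sg s k) p v w =
  (2 * a ^- 2 * (p 0 i0 + s) * v 0 i0 + dvalley (p 0 i1) * v 0 i1) * w 0 i0
  + (dvalley (p 0 i1) * v 0 i0
      + ((p 0 i0 + s) * ddvalley (p 0 i1) + sg * a * (ddhill (p 0 i1) * k)) * v 0 i1) * w 0 i1
  + \sum_j 2 * e j * v 0 j * w 0 j.
Proof.
rewrite (hessian_grad v w grad_at_straight (grad_at_straight_grad p)).
under eq_bigr do rewrite dot_straight_hess 2!mulrDl.
rewrite !big_split/=; congr (_ + _ + _).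
  rewrite (bigD1 i0)//= mul1r big1 ?addr0// => i /negbTE ->.
  by rewrite !mul0r.
rewrite (bigD1 i1)//= mul1r big1 ?addr0// => i /negbTE ->.
by rewrite !mul0r.
Qed.

End Straight.

Lemma diag_dominant (al be d vx vy : R) : 16 <= `|al| -> 16 <= `|be| -> `|d| <= 8 ->
  al * vx + d * vy = 0 -> d * vx + be * vy = 0 -> vx = 0 /\ vy = 0.
Proof.
move=> al16 be16 d8 eqx eqy.
have vxy : 16 * `|vx| <= 8 * `|vy|.
  have : `|al| * `|vx| = `|d| * `|vy| by rewrite -!normrM -normrN; congr `|_|; lra.
  have := normr_ge0 vx; have := normr_ge0 vy; nra.
have vyx : 16 * `|vy| <= 8 * `|vx|.
  have : `|be| * `|vy| = `|d| * `|vx| by rewrite -!normrM -normrN; congr `|_|; lra.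
  have := normr_ge0 vx; have := normr_ge0 vy; nra.
by split; apply/eqP; rewrite -normr_le0; have := normr_ge0 vx; have := normr_ge0 vy; lra.
Qed.

(** Both the gradient at [p] and the image of a vector [v] of the radical under
    the corrected Hessian are normal, with factors [mu] and [nu].  Off the plane
    [z = 0], [mu = 2 e_i] gives [nu = 0] and kills all entries of [v] in turn,
    the [i]-th one by tangency.  On the circle, [v] is [t (-y, x)] and
    [circle_nondeg] gives [t = 0]. *)
Lemma nondegenerate_bd_base F p : (forall x, dot x x = 1 -> F x = base x) ->
  crit_bd F p -> nondegenerate_bd_at F p.
Proof.
move=> Fb [/enorm_eq1 p1 Dp] v pv Hv; have {}pv : dot p v = 0 := pv.
have gb := grad_at_straight 0 0 0.
have gH := grad_at_straight_grad 0 0 0 p.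
have c0 := inv_sqr_ge a_gt0 a_le.
set mu := dot p (straight_grad 0 0 0 p).
have gmu : straight_grad 0 0 0 p = mu *: p.
  apply: orthogonal_normal => // w pw.
  by rewrite -(sphere_derive p1 Fb gb pw); exact: Dp.
pose u : E := \row_j dot (straight_hess 0 0 0 p j) v - mu *: v.
set nu := dot p u; have uE : u = nu *: p.
  apply: orthogonal_normal => // w pw.
  have := Hv w pw; rewrite (sphere_hessian p1 Fb gb gH pv pw) => <-.
  rewrite /u dotDl -scaleNr dotZl mulNr; congr (_ - _).
  by apply: eq_bigr => j _; rewrite mxE.
have gi j := congr1 (fun q : E => q 0 j) gmu.
have ui j := congr1 (fun q : E => q 0 j) uE.
set c := a ^- 2 in c0 *; set x : R := p 0 i0; set y : R := p 0 i1.
have gx : c * x ^+ 2 + valley y = mu * x.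
  by have := gi i0; rewrite !mxE /= e0 !addr0 => <-; rewrite /c /x /y; ring.
have gy : x * dvalley y = mu * y.
  by have := gi i1; rewrite !mxE /= e1 !addr0 => <-; rewrite /c /x /y; ring.
have gz j : j != i0 -> j != i1 -> p 0 j != 0 -> mu = 2 * e j.
  move=> nj0 nj1 pj; apply: (mulIf pj); have := gi j.
  by rewrite !mxE /= (negbTE nj0) (negbTE nj1) !mulr0 !add0r.
have ux : (2 * c * x - mu) * v 0 i0 + dvalley y * v 0 i1 = nu * x.
  have := ui i0; rewrite !mxE dot_straight_hess /= e0 !addr0 => <-.
  by rewrite /c /x /y; ring.
have uy : dvalley y * v 0 i0 + (x * ddvalley y - mu) * v 0 i1 = nu * y.
  have := ui i1; rewrite !mxE dot_straight_hess /= e1 !addr0 => <-.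
  by rewrite /c /x /y; ring.
have uz j : j != i0 -> j != i1 -> (2 * e j - mu) * v 0 j = nu * p 0 j.
  move=> nj0 nj1; have := ui j.
  rewrite !mxE dot_straight_hess (negbTE nj0) (negbTE nj1) !mulr0n => <-; ring.
have x2 : x ^+ 2 <= 1 by rewrite -p1 coord_sqr_le.
have y2 : y ^+ 2 <= 1 by rewrite -p1 coord_sqr_le.
have x1 : `|x| <= 1 by rewrite ler_norml; apply/andP; split; nra.
have [ym1 y1] : -1 <= y /\ y <= 1 by split; nra.
have dg8 := dvalley_bound ym1 y1; have ddg12 := ddvalley_bound ym1 y1.
suff vE : v 0 i0 = 0 /\ v 0 i1 = 0 /\ forall j, j != i0 -> j != i1 -> v 0 j = 0.
  have [vx [vy vz]] := vE; apply/rowP => j; rewrite mxE.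
  by have [->|nj0] := eqVneq j i0; [|have [->|nj1] := eqVneq j i1; [|exact: vz]].
have [/existsP[i /and3P[ni0 ni1 pi]]|] :=
    boolP [exists i : 'I_n, [&& i != i0, i != i1 & p 0 i != 0]].
  have muE := gz i ni0 ni1 pi.
  have nu0 : nu = 0.
    have := uz i ni0 ni1; rewrite muE subrr mul0r => /esym/eqP.
    by rewrite mulf_eq0 (negbTE pi) orbF => /eqP.
  have mu_large : 2 * c + 200 <= `|mu|.
    by rewrite muE normrM ger0_norm//; have := e_large ni0 ni1; rewrite -/c; lra.
  have [vx vy] : v 0 i0 = 0 /\ v 0 i1 = 0.
    apply: (diag_dominant (al := 2 * c * x - mu) (be := x * ddvalley y - mu) (d := dvalley y)) => //.
    - have := lerB_dist mu (2 * c * x); rewrite distrC.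
      have : `|2 * c * x| <= 2 * c.
        by rewrite normrM ger0_norm ?ler_piMr//; lra.
      lra.
    - have := lerB_dist mu (x * ddvalley y); rewrite distrC.
      have : `|x * ddvalley y| <= 1 * 12 by rewrite normrM ler_pM.
      lra.
    - by rewrite ux nu0 mul0r.
    - by rewrite uy nu0 mul0r.
  have vz j : j != i0 -> j != i1 -> j != i -> v 0 j = 0.
    move=> nj0 nj1 ji; have := uz j nj0 nj1; rewrite nu0 mul0r => /eqP.
    rewrite mulf_eq0 subr_eq0 muE => /orP[/eqP ee|/eqP//].
    have /(e_inj nj0 nj1 ni0 ni1)/eqP : e j = e i by lra.
    by rewrite (negbTE ji).
  have vi : v 0 i = 0.
    move: pv; rewrite /dot (bigD1 i)//= big1 ?addr0 => [|j ji].
      by move/eqP; rewrite mulf_eq0 (negbTE pi) => /eqP.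
    have [->|nj0] := eqVneq j i0; first by rewrite vx mulr0.
    have [->|nj1] := eqVneq j i1; first by rewrite vy mulr0.
    by rewrite vz// mulr0.
  split=> //; split=> // j nj0 nj1.
  by have [->|ji] := eqVneq j i; [|exact: vz].
rewrite negb_exists => /forallP noz.
have pz j : j != i0 -> j != i1 -> p 0 j = 0.
  by move=> nj0 nj1; have := noz j; rewrite nj0 nj1 negbK => /eqP.
have r1 : x ^+ 2 + y ^+ 2 = 1 by rewrite -p1 (dot_planar _ pz) !expr2.
have mu_small : `|mu| <= c + 13.
  by apply: circle_mu r1 gx gy; apply: le_trans c0.
have vz j : j != i0 -> j != i1 -> v 0 j = 0.
  move=> nj0 nj1; have := uz j nj0 nj1; rewrite pz// mulr0 => /eqP.
  rewrite mulf_eq0 subr_eq0 => /orP[/eqP muE|/eqP//].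
  have := e_large nj0 nj1; rewrite -/c.
  by move: mu_small; rewrite -muE normrM ger0_norm//; lra.
have pv2 : x * v 0 i0 + y * v 0 i1 = 0 by rewrite -(dot_planar _ pz).
pose t := x * v 0 i1 - y * v 0 i0.
have vx : v 0 i0 = - y * t.
  transitivity (v 0 i0 * (x ^+ 2 + y ^+ 2) - x * (x * v 0 i0 + y * v 0 i1)).
    by rewrite r1 pv2; ring.
  by rewrite /t; ring.
have vy : v 0 i1 = x * t.
  transitivity (v 0 i1 * (x ^+ 2 + y ^+ 2) - y * (x * v 0 i0 + y * v 0 i1)).
    by rewrite r1 pv2; ring.
  by rewrite /t; ring.
have : t * ((2 * c * x - mu) * y ^+ 2 - 2 * (dvalley y * x * y)
    + (x * ddvalley y - mu) * x ^+ 2) = 0.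
  transitivity (- y * ((2 * c * x - mu) * v 0 i0 + dvalley y * v 0 i1)
     + x * (dvalley y * v 0 i0 + (x * ddvalley y - mu) * v 0 i1)); first by rewrite vx vy; ring.
  by rewrite ux uy; ring.
move/eqP; rewrite mulf_eq0 (negbTE (circle_nondeg c0 r1 gx gy)) orbF => /eqP t0.
by rewrite vx vy t0 !mulr0.
Qed.

Definition planar_part sg v : R :=
  (2 * sg / a * v 0 i0 - 2 / 5 * v 0 i1) * v 0 i0
  + (sg * a * (18 / 5 + ddhill 0) * v 0 i1 - 2 / 5 * v 0 i0) * v 0 i1.

Lemma hessian_germ sg v w : hessian (germ sg) 0 v w =
  (2 * sg / a * v 0 i0 - 2 / 5 * v 0 i1) * w 0 i0
  + (sg * a * (18 / 5 + ddhill 0) * v 0 i1 - 2 / 5 * v 0 i0) * w 0 i1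
  + \sum_j 2 * e j * v 0 j * w 0 j.
Proof.
rewrite hessian_straight !mxE /dvalley /ddvalley; congr (_ + _).
by field; rewrite gt_eqF.
Qed.

(** With [v_x = a u] the form is [a] times a form in [u] and [v_y] whose diagonal
    coefficients, at least [2] and [18/5], dominate the mixed one, [4/5]. *)
Lemma planar_part_gt0 sg v : sg ^+ 2 = 1 -> (v 0 i0 != 0) || (v 0 i1 != 0) ->
  0 < sg * planar_part sg v.
Proof.
move=> sg1 v0; rewrite /planar_part; have := ddhill0 R.
move: (ddhill 0) (v 0 i1) v0 => D y v0 D0; have an0 : a != 0 by rewrite gt_eqF.
have [u vE] : exists u, v 0 i0 = a * u by exists (v 0 i0 / a); field.
have {}v0 : 0 < u ^+ 2 + y ^+ 2.
  rewrite lt_neqAle addr_ge0 ?sqr_ge0// andbT eq_sym paddr_eq0 ?sqr_ge0//.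
  by rewrite !sqrf_eq0 negb_and; move: v0; rewrite vE mulf_eq0 (negbTE an0).
have -> : sg * ((2 * sg / a * v 0 i0 - 2 / 5 * y) * v 0 i0 +
    (sg * a * (18 / 5 + D) * y - 2 / 5 * v 0 i0) * y) =
    a * (sg ^+ 2 * (2 * u ^+ 2 + (18 / 5 + D) * y ^+ 2) - 4 / 5 * (u * (sg * y))).
  by rewrite vE; field.
rewrite sg1 mul1r mulr_gt0//.
have : 0 <= (u - sg * y) ^+ 2 := sqr_ge0 _.
rewrite sqrrB exprMn sg1 mul1r.
have : 0 <= D * y ^+ 2 by rewrite mulr_ge0 ?sqr_ge0.
move: (u * (sg * y)) => t; have := sqr_ge0 u; have := sqr_ge0 y; lra.
Qed.

Lemma planar_part_ge0 sg v : sg ^+ 2 = 1 -> 0 <= sg * planar_part sg v.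
Proof.
move=> sg1; have [v0|] := boolP ((v 0 i0 != 0) || (v 0 i1 != 0)).
  exact/ltW/planar_part_gt0.
rewrite negb_or !negbK /planar_part => /andP[/eqP -> /eqP ->].
by rewrite !mulr0 !addr0 mulr0.
Qed.

Lemma hessian_germ_diag sg v :
  hessian (germ sg) 0 v v = planar_part sg v + \sum_j 2 * e j * (v 0 j ^+ 2).
Proof.
by rewrite hessian_germ; congr (_ + _); apply: eq_bigr => j _; ring.
Qed.

Lemma nondegenerate_germ sg : sg ^+ 2 = 1 ->
  nondegenerate_on setT (hessian (germ sg) 0).
Proof.
move=> sg1 v _ Hv.
have dE i j : ('d_i) 0 j = (j == i)%:R :> R by rewrite mxE eqxx.
have vz i : i != i0 -> i != i1 -> v 0 i = 0.
  move=> ni0 ni1; have := Hv 'd_i I.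
  rewrite hessian_germ !dE (eq_sym i0) (eq_sym i1) (negbTE ni0) (negbTE ni1).
  rewrite !mulr0 !add0r (bigD1 i)//= big1 => [|j ji]; last first.
    by rewrite dE (negbTE ji) mulr0.
  rewrite dE eqxx mulr1 addr0 => /eqP; rewrite mulf_eq0 => /orP[|/eqP//].
  rewrite mulf_eq0 pnatr_eq0/= => /eqP ei0.
  have := e_large ni0 ni1; rewrite ei0 normr0.
  have : 0 <= a ^- 2 by rewrite invr_ge0 sqr_ge0.
  lra.
have := planar_part_gt0 (v := v) sg1.
have := Hv v I; rewrite hessian_germ_diag big1 => [|j _]; last first.
  have [->|nj0] := eqVneq j i0; first by rewrite e0 mulr0 mul0r.
  have [->|nj1] := eqVneq j i1; first by rewrite e1 mulr0 mul0r.
  by rewrite vz// expr0n mulr0.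
rewrite addr0 => ->; rewrite mulr0 ltxx.
case: eqP => [v0|] //=; last by move=> _ /(_ isT).
case: eqP => [v1|] //=; last by move=> _ /(_ isT).
move=> _; apply/rowP => i; rewrite mxE.
by have [->|ni0] := eqVneq i i0; [|have [->|ni1] := eqVneq i i1; [|exact: vz]].
Qed.

Lemma quad_term_le0 v j : (0 < e j -> v 0 j = 0) -> 2 * e j * v 0 j ^+ 2 <= 0.
Proof.
move=> vj; have [ej|ej] := lerP (e j) 0; last by rewrite vj// expr0n mulr0.
by apply: mulr_le0_ge0; rewrite ?sqr_ge0// pmulr_rle0.
Qed.

Lemma quad_lt0 v : (forall i, 0 < e i -> v 0 i = 0) ->
  (exists2 i, v 0 i != 0 & e i < 0) -> \sum_j 2 * e j * (v 0 j ^+ 2) < 0.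
Proof.
move=> ve [i vi ei]; rewrite (bigD1 i)//=.
have : \sum_(j < n | j != i) 2 * e j * v 0 j ^+ 2 <= 0.
  by apply: sumr_le0 => j _; exact: quad_term_le0 (ve j).
have : 2 * e i * v 0 i ^+ 2 < 0.
  by rewrite pmulr_llt0 ?pmulr_rlt0// lt_neqAle sqr_ge0 eq_sym sqrf_eq0 vi.
lra.
Qed.

Lemma quad_ge0 v : (forall i, e i < 0 -> v 0 i = 0) ->
  0 <= \sum_j 2 * e j * (v 0 j ^+ 2).
Proof.
move=> ve; apply: sumr_ge0 => j _.
have [ej|ej] := lerP 0 (e j); last by rewrite ve// expr0n mulr0.
by apply: mulr_ge0; [apply: mulr_ge0 | exact: sqr_ge0].
Qed.

Lemma planar_part_eq0 sg v : v 0 i0 = 0 -> v 0 i1 = 0 -> planar_part sg v = 0.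
Proof. by move=> v0 v1; rewrite /planar_part v0 v1; ring. Qed.

Lemma form_index_germ1 :
  form_index (hessian (germ 1) 0) #|[set i | e i < 0]%SET|.
Proof.
apply: (form_index_split (N := [set i | e i < 0]%SET)) => [v v0 vN|v vN].
  rewrite hessian_germ_diag planar_part_eq0 ?add0r; last 2 first.
  - by apply: vN; rewrite inE e0 ltxx.
  - by apply: vN; rewrite inE e1 ltxx.
  apply: quad_lt0 => [i ei|]; first by apply: vN; rewrite inE lt_gtF.
  have /rV0Pn[i vi] := v0; exists i => //.
  by apply: contraNT vi => ei; rewrite vN// inE.
rewrite hessian_germ_diag addr_ge0//.
  by rewrite -[planar_part _ _]mul1r planar_part_ge0// expr1n.
by apply: quad_ge0 => i ei; apply: vN; rewrite inE.
Qed.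

Lemma form_index_germN1 : form_index (hessian (germ (-1)) 0)
  #|[set i | [|| e i < 0, i == i0 | i == i1]]%SET|.
Proof.
have sg1 : (-1) ^+ 2 = 1 :> R by rewrite sqrrN expr1n.
apply: (form_index_split (N := [set i | [|| e i < 0, i == i0 | i == i1]]%SET)) => [v v0 vN|v vN].
  have ve i : 0 < e i -> v 0 i = 0.
    move=> ei; apply: vN; rewrite inE lt_gtF//=; apply/norP; split.
      by apply: contraTneq ei => ->; rewrite e0 ltxx.
    by apply: contraTneq ei => ->; rewrite e1 ltxx.
  rewrite hessian_germ_diag.
  have [vp|] := boolP ((v 0 i0 != 0) || (v 0 i1 != 0)).
    have := planar_part_gt0 sg1 vp; rewrite mulN1r oppr_gt0 => H.
    have : \sum_j 2 * e j * v 0 j ^+ 2 <= 0.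
      by apply: sumr_le0 => j _; exact: quad_term_le0 (ve j).
    by move=> H2; rewrite -[ltRHS]addr0 ltr_leD.
  rewrite negb_or !negbK => /andP[/eqP vx /eqP vy].
  rewrite planar_part_eq0// add0r; apply: quad_lt0 => //.
  have /rV0Pn[i vi] := v0; exists i => //.
  have : i \in [set i | [|| e i < 0, i == i0 | i == i1]]%SET.
    by apply: contraNT vi => iN; rewrite vN.
  rewrite inE => /or3P[//|/eqP ii|/eqP ii]; move: vi.
    by rewrite ii vx eqxx.
  by rewrite ii vy eqxx.
rewrite hessian_germ_diag planar_part_eq0 ?add0r; last 2 first.
- by apply: vN; rewrite inE eqxx orbT.
- by apply: vN; rewrite inE eqxx !orbT.
by apply: quad_ge0 => i ei; apply: vN; rewrite inE ei.
Qed.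

Lemma germ_local_extension sg : sg ^+ 2 = 1 ->
  local_extension (@unit_ball R n) (model sg) 0 (germ sg).
Proof.
move=> sg1; exists [set y : E | dot y y < 1 / 4]; split.
- exact: open_dot_lt.
- by rewrite /= dot0l; lra.
- exact/smooth_smooth_on_open/smooth_straight.
- by move=> y y4 _; rewrite modelE_near.
Qed.

Lemma derive_model0 sg v : sg ^+ 2 = 1 -> 'D_v (model sg) 0 = 0.
Proof.
move=> sg1; have Em : \forall y \near (0 : E), model sg y = germ sg y.
  have n4 : nbhs (0 : E) [set y : E | dot y y < 1 / 4].
    by apply: open_nbhs_nbhs; split; [exact: open_dot_lt | rewrite /= dot0l; lra].
  by near=> y; apply: modelE_near => //; near: y; exact: n4.
rewrite (near_eq_derive _ Em); have [_ ->] := grad_at_straight sg (sg * a) 1 0.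
suff -> : straight_grad sg (sg * a) 1 0 = 0 by rewrite dot0l.
apply/rowP => j; rewrite !mxE dhill0 add0r exprMn sg1 mul1r.
have -> : a ^- 2 * a ^+ 2 = 1 by rewrite mulVf// expf_neq0// gt_eqF.
rewrite /valley /dvalley; ring.
Unshelve. all: by end_near. Qed.

Lemma crit_set_model sg : sg ^+ 2 = 1 -> crit (@unit_ball R n) (model sg) = [set 0].
Proof.
move=> sg1; apply/seteqP; split => p /=.
  move=> /(crit_extension (O := setT) openT (esym (setIT _)) (@smooth_model sg)).
  by case=> // /enorm_le1 p1; exact: crit_model.
move=> ->; split; first by apply/enorm_le1; rewrite dot0l ler01.
exists (model sg); last by move=> v; exact: derive_model0.
exists setT; split=> //; first exact: openT.
exact/smooth_smooth_on_open/smooth_model.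
Qed.

Lemma morse_model sg : sg ^+ 2 = 1 -> morse (@unit_ball R n) (model sg).
Proof.
move=> sg1; split.
- move=> x _; exists (model sg), setT; split=> //; first exact: openT.
  exact/smooth_smooth_on_open/smooth_model.
- rewrite crit_set_model//; apply/seteqP; split=> // x [-> /enorm_eq1].
  by rewrite dot0l => /esym/eqP; rewrite oner_eq0.
- rewrite crit_set_model// => p ->; exists (germ sg); first exact: germ_local_extension.
  exact: nondegenerate_germ.
- move=> p; apply: nondegenerate_bd_base => x x1.
  by apply: modelE_far; rewrite x1; lra.
Qed.

Definition shell : set E := @unit_ball R n `&` [set x | 3 / 4 < dot x x].

Lemma sphere_nbhd_shell : sphere_nbhd shell.
Proof.
split; first by exists [set x : E | 3 / 4 < dot x x] => //; exact: open_dot_gt.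
move=> x /enorm_eq1 x1; split; first by apply/enorm_le1; rewrite x1.
by rewrite /= x1; lra.
Qed.

Lemma crit_shell : crit shell base = set0.
Proof.
have sg1 : 1 ^+ 2 = 1 :> R by rewrite expr1n.
apply/seteqP; split=> // x.
move=> /(crit_extension (@open_dot_gt R n (3 / 4)) (erefl _) (@smooth_model 1)).
case=> [y [_ /= y34]|[/enorm_le1 x1 /= x34] Dx]; first by rewrite modelE_far// ltW.
by move: x34; rewrite (crit_model sg1 x1 Dx) dot0l; lra.
Qed.

Lemma morse_shell : morse shell base.
Proof.
split.
- move=> x _; exists base, setT; split=> //; first exact: openT.
  exact/smooth_smooth_on_open/smooth_straight.
- by rewrite crit_shell set0I.
- by rewrite crit_shell.
- by move=> p; apply: nondegenerate_bd_base.
Qed.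

Lemma admits_index_model sg k : sg ^+ 2 = 1 ->
  form_index (hessian (germ sg) 0) k -> admits_index shell base k.
Proof.
move=> sg1 ik; exists (model sg); split.
- exact: morse_model.
- by move=> x [_ /= x34]; rewrite modelE_far// ltW.
- exact: crit_set_model.
- by exists (germ sg) => //; exact: germ_local_extension.
Qed.

End Model.

(** * The theorem *)

Lemma card_ord_ltn n k : (k <= n)%N -> #|[set i : 'I_n | (i < k)%N]%SET| = k.
Proof.
move=> kn; rewrite -sum1_card (eq_bigl (fun i : 'I_n => (i < k)%N)) => [|i]; last first.
  by rewrite inE.
by rewrite (big_ord_narrow kn) sum1_card card_ord.
Qed.

Theorem theorem4p1 (R : realType) (n lam : nat)
    (hn : (2 <= n)%N) (hlam : (lam <= n - 2)%N) :
  exists (U : set 'rV[R]_n) (f : 'rV[R]_n -> R),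
    [/\ sphere_nbhd U, morse U f, crit U f = set0,
        admits_index U f lam & admits_index U f (lam + 2)].
Proof.
case: n hn hlam => [|[|m]]// _; rewrite subn2/= => lam_le.
set K : R := 64 * expR 1; have K0 : 0 <= K by rewrite mulr_ge0// expR_ge0.
set h := hill_height R; have h0 : 0 <= h by exact/ltW/hill_height_gt0.
(* a makes the products of a with 1, K, h and K * h at most 1 / 100 *)
pose b := 100 * ((1 + K) * (1 + h)).
have b0 : 0 < b by rewrite /b !mulr_gt0//; lra.
pose a := b^-1; have a0 : 0 < a by rewrite invr_gt0.
have ab : a * b = 1 by rewrite mulVf// gt_eqF.
have Kh : 0 <= K * h by rewrite mulr_ge0.
have bE : b = 100 + 100 * K + 100 * h + 100 * (K * h) by rewrite /b; ring.
have bound t : 0 <= t -> 100 * t <= b -> a * t <= 1 / 100.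
  by move=> t0 tb; rewrite -ler_pdivlMl//invrK; lra.
have a_le : a <= 1 / 100 by rewrite -[a]mulr1; apply: bound; lra.
have a_hill : a * h * K <= 1 / 100 by rewrite -mulrA (mulrC h); apply: bound; lra.
have a_cut : a * K <= 1 / 100 by apply: bound; lra.
pose L : R := a ^- 2 + 100; have L0 : 0 < L.
  by rewrite /L ltr_wpDl// invr_ge0 sqr_ge0.
(* the shift by i makes the absolute values distinct *)
pose e (i : 'I_m.+2) : R :=
  if (i < 2)%N then 0 else (if (i < lam + 2)%N then -1 else 1) * (L + i%:R).
have ne i : i != ord0 :> 'I_m.+2 -> i != lift ord0 ord0 -> (i < 2)%N = false.
  by case: i => [[|[|i]]].
have Li i : 0 < L + i%:R :> R by rewrite ltr_wpDr.
have norm_e i : i != ord0 -> i != lift ord0 ord0 -> `|e i| = L + i%:R.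
  move=> i0 i1; rewrite /e ne//; case: ifP => _.
    by rewrite mulN1r normrN gtr0_norm.
  by rewrite mul1r gtr0_norm.
have e_large i : i != ord0 -> i != lift ord0 ord0 -> a ^- 2 + 100 <= `|e i|.
  by move=> i0 i1; rewrite norm_e// lerDl.
have e_inj i j : i != ord0 -> i != lift ord0 ord0 -> j != ord0 -> j != lift ord0 ord0 ->
    e i = e j -> i = j.
  move=> i0 i1 j0 j1 eij; apply/ord_inj/eqP; rewrite -(eqr_nat R).
  by rewrite -(inj_eq (addrI L)) -!norm_e// eij.
have e_lt0 i : (e i < 0) = (2 <= i < lam + 2)%N.
  rewrite /e ltnNge; case: (leqP 2 i) => i2 /=; last by rewrite ltxx.
  by case: ifP => _; rewrite ?mulN1r ?mul1r ?oppr_lt0 ?Li// lt_gtF.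
have card2 : #|[set i : 'I_m.+2 | (i < lam + 2)%N]%SET| = (lam + 2)%N.
  by rewrite card_ord_ltn// addn2.
exists (@shell R m), (base a e); split.
- exact: sphere_nbhd_shell.
- exact: morse_shell.
- exact: crit_shell.
- apply: (@admits_index_model R m a e a0 a_le a_hill a_cut _ _ e_large e_inj 1) => //.
    by rewrite expr1n.
  suff <- : #|[set i | e i < 0]%SET| = lam by exact: form_index_germ1.
  rewrite (_ : [set i | e i < 0]%SET =
    [set i : 'I_m.+2 | (i < lam + 2)%N]%SET :\: [set i : 'I_m.+2 | (i < 2)%N]%SET)%SET.
    rewrite cardsD card2 (finset.setIidPr _) ?card_ord_ltn ?addnK//.
    by apply/fintype.subsetP => i; rewrite !inE => /leq_trans; apply; rewrite leq_addl.
  by apply/setP => i; rewrite !inE e_lt0 -leqNgt.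
- apply: (@admits_index_model R m a e a0 a_le a_hill a_cut _ _ e_large e_inj (-1)) => //.
    by rewrite sqrrN expr1n.
  rewrite -card2 (_ : [set i : 'I_m.+2 | (i < lam + 2)%N]%SET =
    [set i | [|| e i < 0, i == ord0 | i == lift ord0 ord0]]%SET).
    exact: form_index_germN1.
  apply/setP => i; rewrite !inE e_lt0.
  have [-> | i0] := eqVneq i ord0; first by rewrite addn2.
  have [-> | i1] := eqVneq i (lift ord0 ord0); first by rewrite addn2.
  by rewrite !orbF (leqNgt 2) ne.
Qed.
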